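(* Let $X_1,X_2,\dots$ be i.i.d. random variables with distribution function $F(x)=x^{\lambda}$, $x\in(0,1)$, for some $\lambda>0$, and let $I_n^{PR}=\int_0^1\bigl(H_n(t)-F_n(t)\bigr)\,dF_n(t)$. Then, as $n\to\infty$, $$\sqrt n\, I_n^{PR}\ \stackrel{d}{\longrightarrow}\ \mathcal N\left(0,\tfrac{5}{108}\right).$$
   Context: For a sample $X_1,\dots,X_n$ of $(0,1)$-valued random variables, $F_n(t)=n^{-1}\sum_{i=1}^n \mathbf 1\{X_i<t\}$ is the empirical distribution function and $$H_n(t)=\binom n2^{-1}\sum_{1\le i<j\le n}\mathbf 1\left\{\min\left(\tfrac{X_i}{X_j},\tfrac{X_j}{X_i}\right)<t\right\}$$ is the $U$-empirical distribution function. The integral with respect to $dF_n$ is the average over the sample points. $\mathcal N(0,\sigma^2)$ denotes the centred normal law with variance $\sigma^2$. *)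

(* Defs.v *)
From HB Require Import structures.
From mathcomp Require Import all_boot all_order all_algebra finmap.
From mathcomp Require Import all_classical all_reals all_analysis.
From mathcomp Require Import measurable_realfun.

Set Implicit Arguments.
Unset Strict Implicit.
Unset Printing Implicit Defensive.

Import Order.TTheory GRing.Theory Num.Theory.
Import numFieldTopology.Exports numFieldNormedType.Exports.

Local Open Scope classical_set_scope.
Local Open Scope ring_scope.

Section probability_notions.
Context d (T : measurableType d) (R : realType) (P : probability T R).

Definition mutually_independent (I : choiceType) (X : I -> {RV P >-> R}) :=
  forall (J : {fset I}) (B : I -> set R), (forall i, measurable (B i)) ->
    P (\bigcap_(i in [set` J]) (X i @^-1` B i)) =
    (\prod_(i <- J) P (X i @^-1` B i))%E.

Definition cvg_in_distribution (Y : nat -> {RV P >-> R})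
    (mu : probability (measurableTypeR R) R) :=
  forall x : R, {for x, continuous (fun y : R => mu `]-oo, y]%classic)} ->
    cdf (Y n) x @[n --> \oo] --> mu `]-oo, x]%classic.

End probability_notions.

(* Indexing is from 0: the sample of size n is x 0, ..., x n.-1. The
   normalizing factors 1/n and 1/'C(n, 2) are junk (zero) for n = 0 and n < 2
   respectively, which is irrelevant for limits as n --> \oo. *)
Section empirical.
Context (R : realType).
Implicit Types (x : nat -> R) (n : nat) (t : R).

Definition empirical_df x n t : R :=
  n%:R^-1 * \sum_(i < n) (x i < t)%R%:R.

Definition U_empirical_df x n t : R :=
  'C(n, 2)%:R^-1 *
  \sum_(j < n) \sum_(i < n | (i < j)%N)
    (Num.min (x i / x j) (x j / x i) < t)%R%:R.

(* \int (H_n - F_n) dF_n: integration against dF_n is the average over the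
   sample points. *)
Definition I_PR x n : R :=
  n%:R^-1 * \sum_(k < n) (U_empirical_df x n (x k) - empirical_df x n (x k)).

End empirical.

Section statistic.
Context d (T : measurableType d) (R : realType) (P : probability T R).
Variables (X : nat -> {RV P >-> R}) (n : nat).

Definition I_PR_stat (w : T) : R := I_PR (fun i => X i w) n.

Let measurable_inv : measurable_fun [set: R] (@GRing.inv R).
Proof.
have -> : [set: R] = [set x | x != 0] `|` [set 0].
  by apply/seteqP; split=> x //= _; have [->|] := eqVneq x 0; [right|left].
have oN0 : open [set x : R | x != 0].
  have -> : [set x : R | x != 0] = ~` [set 0].
    by apply/seteqP; split=> x /= /eqP.
  exact/closed_openC/closed_eq.
apply/measurable_funU => //; first exact: open_measurable.
split; last exact: measurable_fun_set1.
apply: open_continuous_measurable_fun => // x; rewrite inE /= => x0.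
exact: inv_continuous.
Qed.

Let measurable_nat_of_bool (f g : T -> R) :
  measurable_fun setT f -> measurable_fun setT g ->
  measurable_fun setT (fun w => (f w < g w)%R%:R : R).
Proof.
move=> mf mg.
have -> : (fun w => (f w < g w)%R%:R : R) = (fun w => if f w < g w then 1 else 0).
  by apply/funext => w; case: ifP.
by apply: measurable_fun_ifT => //; exact: measurable_fun_ltr.
Qed.

Let measurable_I_PR_stat : measurable_fun [set: T] I_PR_stat.
Proof.
have mX i : measurable_fun setT (fun w => X i w) by [].
have mXV i j : measurable_fun setT (fun w => X i w / X j w).
  by apply: measurable_funM => //; exact: (measurableT_comp measurable_inv).
apply: measurable_funM => //; apply: measurable_sum => k.
apply: measurable_funB; apply: measurable_funM => //; apply: measurable_sum => j.
  under eq_fun do rewrite big_mkcond.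
  apply: measurable_sum => i; case: (i < j)%N => //.
  by apply: measurable_nat_of_bool => //; exact: measurable_minr.
exact: measurable_nat_of_bool.
Qed.

HB.instance Definition _ :=
  isMeasurableFun.Build _ _ _ _ I_PR_stat measurable_I_PR_stat.

End statistic.

(* Main.v *)
(* Only order relations between the X_i and between their ratios enter the
   statistic, so X_i may be replaced by X_i^lambda, which is uniform.  For uniform
   variables the kernel 1{min(x/y, y/x) < z} has mean 1/2 and projections
   1/2 - x/2 + x ln x (on x and on y) and z - 1/2 (on z); they add up to the score
   1/2 + 2 x ln x, of variance 5/108.  A product of two degenerate remainders has
   mean zero unless the six indices take at most four values, so the squared sum of
   the remainders has mean O(n^4) and is negligible after normalization.  The score
   sum obeys the central limit theorem by Stein's method: a test function g with
   compact support and Gaussian mean zero is g(x) = s^2 f'(x) - x f(x) with f also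
   compactly supported, and independence gives E (s^2 f'(W) - W f(W)) = O(1/sqrt n).
   Recentring by a wide bump removes the mean zero restriction up to the tails,
   which Chebyshev's inequality controls. *)

Require Import Defs.
From HB Require Import structures.
From mathcomp Require Import all_boot all_order all_algebra finmap.
From mathcomp Require Import all_classical all_reals all_analysis.
From mathcomp Require Import measurable_realfun.
From mathcomp Require Import ring lra.

Set Implicit Arguments.
Unset Strict Implicit.
Unset Printing Implicit Defensive.

Import Order.TTheory GRing.Theory Num.Theory.
Import numFieldTopology.Exports numFieldNormedType.Exports.

Local Open Scope classical_set_scope.
Local Open Scope ring_scope.

(** * Bounded integrands *)

(** The Hoeffding decomposition is stopped at first order, so the remainder kernel has mean zero
    given any one argument, but not given two. One of the two triples in a product must therefore
    offer two indices that occur nowhere else, and five distinct values among six suffice for that.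
    The threshold index may coincide with an index of the pair; such triples fall under the same
    count.

    Two choices shape the rest. Every integrand is made bounded, by truncating functions of the unit
    interval outside it, so that integrability and Fubini come at once. A function of the variables
    with indices in [J] is encoded as a measurable function on [T] with a smaller sigma-algebra, so
    that independence becomes a product law on [R * T] and joint laws of vectors never appear. Ties
    are excluded only almost surely, so they survive as an explicit term of mean zero. *)

Definition bounded_mfun d (S : measurableType d) (R : realType) (f : S -> R) :=
  measurable_fun setT f /\ exists M, forall x, `|f x| <= M.

Section bounded_mfun_theory.
Context d (S : measurableType d) (R : realType).
Implicit Types f g : S -> R.

Lemma bounded_mfun_cst (c : R) : bounded_mfun (fun _ : S => c).
Proof. by split; [exact: measurable_cst|exists `|c|]. Qed.

Lemma bounded_mfunD f g : bounded_mfun f -> bounded_mfun g ->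
  bounded_mfun (fun x => f x + g x).
Proof.
move=> [mf [M fM]] [mg [N gN]]; split; first exact: measurable_funD.
by exists (M + N) => x; rewrite (le_trans (ler_normD _ _))// lerD.
Qed.

Lemma bounded_mfunN f : bounded_mfun f -> bounded_mfun (fun x => - f x).
Proof.
move=> [mf [M fM]]; split; first exact: measurableT_comp.
by exists M => x; rewrite normrN.
Qed.

Lemma bounded_mfunB f g : bounded_mfun f -> bounded_mfun g ->
  bounded_mfun (fun x => f x - g x).
Proof. by move=> ? ?; apply: bounded_mfunD => //; exact: bounded_mfunN. Qed.

Lemma bounded_mfunM f g : bounded_mfun f -> bounded_mfun g ->
  bounded_mfun (fun x => f x * g x).
Proof.
move=> [mf [M fM]] [mg [N gN]]; split; first exact: measurable_funM.
by exists (M * N) => x; rewrite normrM ler_pM.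
Qed.

Lemma bounded_mfunZ (c : R) f : bounded_mfun f ->
  bounded_mfun (fun x => c * f x).
Proof. by move=> ?; apply: bounded_mfunM => //; exact: bounded_mfun_cst. Qed.

Lemma bounded_mfun_norm f : bounded_mfun f -> bounded_mfun (fun x => `|f x|).
Proof.
move=> [mf [M fM]]; split; first exact: measurableT_comp.
by exists M => x; rewrite normr_id.
Qed.

Lemma bounded_mfun_sum (I : Type) (s : seq I) (p : pred I) (F : I -> S -> R) :
  (forall i, p i -> bounded_mfun (F i)) ->
  bounded_mfun (fun x => \sum_(i <- s | p i) F i x).
Proof.
move=> bF; elim: s => [|i s ih].
  by under eq_fun do rewrite big_nil; exact: bounded_mfun_cst.
under eq_fun do rewrite big_cons.
case: (boolP (p i)) => // pi; apply: bounded_mfunD => //; exact: bF.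
Qed.

Lemma bounded_mfun_comp d' (S' : measurableType d') (h : S' -> S) f :
  measurable_fun setT h -> bounded_mfun f -> bounded_mfun (f \o h).
Proof.
move=> mh [mf [M fM]]; split; first exact: measurableT_comp.
by exists M => x; exact: fM.
Qed.

Variable m : probability S R.

Lemma bounded_mfun_integrable f : bounded_mfun f ->
  m.-integrable setT (EFin \o f).
Proof.
move=> [mf [M fM]]; apply: measurable_bounded_integrable => //.
  by move: (probability_setT m) => /= ->; exact: ltry.
by exists M; split; rewrite ?num_real// => y My x _ /=; exact: le_trans (fM x) (ltW My).
Qed.

Lemma Rintegral_prob_cst (c : R) : \int[m]_x c = c.
Proof.
rewrite Rintegral_cst//; have /= -> := probability_setT m.
by rewrite mulr1.
Qed.

Lemma bounded_RintegralD f g : bounded_mfun f -> bounded_mfun g ->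
  \int[m]_x (f x + g x) = \int[m]_x f x + \int[m]_x g x.
Proof. by move=> bf bg; rewrite RintegralD//; exact: bounded_mfun_integrable. Qed.

Lemma bounded_RintegralB f g : bounded_mfun f -> bounded_mfun g ->
  \int[m]_x (f x - g x) = \int[m]_x f x - \int[m]_x g x.
Proof. by move=> bf bg; rewrite RintegralB//; exact: bounded_mfun_integrable. Qed.

Lemma bounded_RintegralZ (c : R) f : bounded_mfun f ->
  \int[m]_x (c * f x) = c * \int[m]_x f x.
Proof. by move=> bf; rewrite RintegralZl//; exact: bounded_mfun_integrable. Qed.

Lemma bounded_Rintegral_sum (I : Type) (s : seq I) (p : pred I)
    (F : I -> S -> R) : (forall i, p i -> bounded_mfun (F i)) ->
  \int[m]_x (\sum_(i <- s | p i) F i x) = \sum_(i <- s | p i) \int[m]_x F i x.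
Proof.
move=> bF; elim: s => [|i s ih].
  rewrite big_nil; under eq_Rintegral do rewrite big_nil.
  exact: Rintegral_prob_cst.
rewrite big_cons; under eq_Rintegral do rewrite big_cons.
case: (boolP (p i)) => // pi; rewrite bounded_RintegralD ?ih//; first exact: bF.
exact: bounded_mfun_sum.
Qed.

Lemma bounded_le_Rintegral f g : bounded_mfun f -> bounded_mfun g ->
  (forall x, f x <= g x) -> \int[m]_x f x <= \int[m]_x g x.
Proof.
by move=> bf bg fg; apply: le_Rintegral => //; exact: bounded_mfun_integrable.
Qed.

Lemma bounded_le_normr_Rintegral f : bounded_mfun f ->
  `|\int[m]_x f x| <= \int[m]_x `|f x|.
Proof. by move=> bf; apply: le_normr_Rintegral => //; exact: bounded_mfun_integrable. Qed.

Lemma normr_Rintegral_le (M : R) f : bounded_mfun f -> (forall x, `|f x| <= M) ->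
  `|\int[m]_x f x| <= M.
Proof.
move=> bf fM; rewrite (le_trans (bounded_le_normr_Rintegral bf))//.
rewrite -[leRHS]Rintegral_prob_cst; apply: bounded_le_Rintegral => //.
  exact: bounded_mfun_norm.
exact: bounded_mfun_cst.
Qed.

Lemma bounded_mfun_indic (A : set S) : measurable A -> bounded_mfun (\1_A : S -> R).
Proof.
move=> mA; split; first exact: measurable_indic.
by exists 1 => x; rewrite indicE; case: (_ \in _); rewrite ?normr1 ?normr0.
Qed.

Lemma Rintegral_indic_prob (A : set S) : measurable A ->
  (\int[m]_x (\1_A x : R))%:E = m A.
Proof.
by move=> mA; rewrite /Rintegral integral_indic// setIT fineK// fin_num_measure.
Qed.

End bounded_mfun_theory.

Lemma Rintegral_distribution d d' (S : measurableType d) (S' : measurableType d')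
    (R : realType) (m : probability S R) (h : {mfun S >-> S'})
    (g : S' -> R) : bounded_mfun g ->
  \int[m]_x g (h x) = \int[distribution m h]_y g y.
Proof.
move=> bg; have bgh := bounded_mfun_comp (measurable_funPT h) bg.
rewrite /Rintegral integral_distribution//=.
- by apply/measurable_EFinP; case: bg.
- by have := bounded_mfun_integrable m bgh.
Qed.

Section bounded_fubini.
Context d1 d2 (S1 : measurableType d1) (S2 : measurableType d2) (R : realType).
Variables (m1 : probability S1 R) (m2 : probability S2 R) (f : S1 * S2 -> R).
Hypothesis bf : bounded_mfun f.

Lemma bounded_mfun_section y : bounded_mfun (fun x => f (x, y)).
Proof. by apply: (bounded_mfun_comp _ bf); exact: measurable_pair2. Qed.

Let bounded_prod_integrable :
  ((m1 \x m2)%E : set (S1 * S2) -> \bar R).-integrable setT (EFin \o f).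
Proof.
exact: (@bounded_mfun_integrable _ _ _ ((m1 \x m2)%E : probability _ _)).
Qed.

Lemma bounded_mfun_Rintegral_section :
  bounded_mfun (fun y => \int[m1]_x f (x, y)).
Proof.
split.
  have := measurable_fubini_G bounded_prod_integrable.
  rewrite /fubini_G => mG.
  apply: measurableT_comp mG; exact: fine_measurable.
by have [mf [M fM]] := bf; exists M => y; apply: normr_Rintegral_le => //;
  exact: bounded_mfun_section.
Qed.

Lemma bounded_Rintegral_fubini :
  \int[(m1 \x m2)%E]_z f z = \int[m2]_y \int[m1]_x f (x, y).
Proof.
rewrite /Rintegral -integral21_prod_meas1//; congr fine.
apply: eq_integral => y _; rewrite /fubini_G fineK//.
apply: integrable_fin_num => //=.
by apply: bounded_mfun_integrable; exact: bounded_mfun_section.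
Qed.

End bounded_fubini.

(** * Independence *)

Section independence.
Context d (T : measurableType d) (R : realType) (P : probability T R).
Variable X : nat -> {RV P >-> R}.

(** A pi-system: equality of two finite measures on the generated sigma-algebra has to be checked
    only on these rectangles. *)
Definition cylinder (J : {fset nat}) : set (set T) :=
  [set A | exists2 B : nat -> set R, (forall i, measurable (B i)) &
    A = \bigcap_(i in [set` J]) (X i @^-1` B i)].

(** The space [T] seen through the coordinates in [J]: a measurable function on it is a random
    variable that depends on those [X i] alone. *)
Definition sigma_cylinder (J : {fset nat}) := g_sigma_algebraType (cylinder J).

Lemma cylinder_measurable J : cylinder J `<=` measurable.
Proof.
move=> _ [B mB ->]; apply: fin_bigcap_measurable => // i _.
exact: measurable_funPTI.
Qed.

Lemma sigma_cylinder_measurable J : <<s cylinder J >> `<=` measurable.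
Proof.
apply: smallest_sub; first exact: sigma_algebra_measurable.
exact: cylinder_measurable.
Qed.

Lemma cylinder_setI J : setI_closed (cylinder J).
Proof.
move=> _ _ [B mB ->] [C mC ->]; exists (fun i => B i `&` C i).
  by move=> i; exact: measurableI.
by rewrite -bigcapI; apply: eq_bigcapr => i _; rewrite preimage_setI.
Qed.

Lemma cylinder_setT J : cylinder J setT.
Proof.
by exists (fun=> setT) => //; apply/seteqP; split.
Qed.

Lemma measurable_sigma_cylinder J (a : nat) : a \in J ->
  measurable_fun setT (X a : sigma_cylinder J -> R).
Proof.
move=> aJ _ B mB; rewrite setTI; apply: sub_sigma_algebra.
exists (fun i => if i == a then B else setT).
  by move=> i; case: ifP.
apply/seteqP; split => [w Bw i _ /=|w /(_ a aJ) /=].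
  by case: eqP => [->|_].
by rewrite eqxx.
Qed.

Hypothesis X_indep : mutually_independent X.

Lemma indep_sigma_cylinder J b (A : set R) (B : set T) : b \notin J ->
  measurable A -> <<s cylinder J >> B ->
  P (X b @^-1` A `&` B) = (P (X b @^-1` A) * P B)%E.
Proof.
move=> bJ mA sB.
have mXA : measurable (X b @^-1` A) by exact: measurable_funPTI.
(* The two measures to compare: [P] restricted to the event of [A], and [P] scaled by the
   probability of that event. *)
have PA0 : 0 <= fine (P (X b @^-1` A)) by rewrite fine_ge0.
pose m1 := mrestr P mXA.
pose m2 := mscale (NngNum PA0) P.
rewrite setIC; transitivity (m2 B); last first.
  by rewrite /m2/= /mscale/= fineK// fin_num_measure.
apply: (@g_sigma_algebra_measure_unique _ _ _ (cylinder J)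
  (@cylinder_measurable J) (fun=> setT) _ _ m1 m2 (@cylinder_setI J)) => //.
- by move=> _; exact: cylinder_setT.
- by rewrite bigcup_const//; exists 0%N.
- move=> _ [C mC ->]; rewrite /m1 /m2 /mrestr /= /mscale /= fineK ?fin_num_measure//.
  pose D i := if i == b then A else C i.
  have mD i : measurable (D i) by rewrite /D; case: ifP.
  have := X_indep (b |` J)%fset mD.
  have Db : D b = A by rewrite /D eqxx.
  rewrite big_fsetU1//= Db => H.
  have E : (\bigcap_(i in [set` J]) (X i @^-1` C i)) `&` X b @^-1` A =
            \bigcap_(i in [set` (b |` J)%fset]) (X i @^-1` D i).
    apply/seteqP; split => [w [Cw Aw] i /= |w Dw].
      rewrite in_fset1U /D; case: eqP => [->//|_] /= iJ; exact: Cw.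
    split; last by have := Dw b; rewrite /= in_fset1U eqxx Db; exact.
    move=> i /= iJ; have := Dw i; rewrite /= in_fset1U iJ orbT /D.
    by case: eqP => [ib|_]; [rewrite -ib iJ in bJ|exact].
  rewrite [LHS](_ : _ = P (\bigcap_(i in [set` (b |` J)%fset]) (X i @^-1` D i))).
    rewrite H X_indep//; congr (_ * _)%E.
    apply: eq_big_seq => i iJ; rewrite /D; case: eqP => // ib.
    by rewrite -ib iJ in bJ.
  by rewrite -E.
- move=> _; apply: (@le_lt_trans _ _ (P (setT `&` X b @^-1` A))) => //.
  rewrite setTI; exact: le_lt_trans (probability_le1 P mXA) (ltry _).
Qed.

(** The pair formed by [X b] and the identity into [sigma_cylinder J] has a product law, so by
    Fubini [X b] can be integrated out with all else frozen. *)
Lemma indep_Rintegral (J : {fset nat}) (b : nat)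
    (f : (R * sigma_cylinder J)%type -> R) : b \notin J -> bounded_mfun f ->
  \int[P]_w f (X b w, w) =
  \int[P]_w \int[distribution P (X b)]_x f (x, w).
Proof.
move=> bJ bf.
have mid : measurable_fun setT (id : T -> sigma_cylinder J).
  by move=> _ A mA; rewrite setTI; exact: (@sigma_cylinder_measurable J).
pose idJ : {mfun T >-> sigma_cylinder J} := mfun_Sub (mem_set mid).
have mpair : measurable_fun setT (fun w => (X b w, w) : R * sigma_cylinder J).
  by apply: measurable_fun_pair => //; exact: measurable_funPT.
pose pairJ : {mfun T >-> (R * sigma_cylinder J)%type} := mfun_Sub (mem_set mpair).
transitivity (\int[distribution P pairJ]_z f z).
  exact: (Rintegral_distribution P pairJ bf).
transitivity (\int[distribution P idJ]_w \int[distribution P (X b)]_x f (x, w)); last first.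
  have bF := bounded_mfun_Rintegral_section (distribution P (X b)) (distribution P idJ) bf.
  exact/esym/(Rintegral_distribution P idJ bF).
rewrite -bounded_Rintegral_fubini//; congr fine.
apply: eq_measure_integral => /= A mA _; apply/esym.
apply: product_measure_unique => // B C mB mC.
have := @indep_sigma_cylinder J b B C bJ mB mC.
by rewrite /= /distribution /pushforward /=.
Qed.

End independence.

(** * Stein's equation *)

Section calculus_bounds.
Context (R : realType).
Implicit Types (f g : R -> R) (K L M : R).

Lemma lipschitz_continuous f L : (forall x y, `|f x - f y| <= L * `|x - y|) ->
  continuous f.
Proof.
move=> Lf x; have L0 : 0 <= L.
  by have := le_trans (normr_ge0 _) (Lf 1 0); rewrite subr0 normr1 mulr1.
apply/cvgrPdist_le => e e0; near=> y.
(* [L + 1] replaces [L] because it is divided by, and [L] may be 0. *)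
rewrite (le_trans (Lf _ _))// (@le_trans _ _ ((L + 1) * `|x - y|))//.
  by rewrite ler_wpM2r// lerDl.
rewrite mulrC -ler_pdivlMr ?ltr_wpDl//.
near: y; apply: cvgr_dist_le; first exact: cvg_id.
by rewrite divr_gt0// ltr_wpDl.
Unshelve. all: by end_near. Qed.

Lemma is_derive_lipschitz f (df : R -> R) M :
  (forall x : R, is_derive x 1 f (df x)) -> (forall x, `|df x| <= M) ->
  forall x y, `|f x - f y| <= M * `|x - y|.
Proof.
move=> fdf dfM x y; wlog yx : x y / y <= x.
  by move=> H; have /orP[/H//|/H] := le_total y x; rewrite distrC (distrC x).
have [] := @MVT_segment R f df y x yx (fun z _ => fdf z).
  apply: continuous_subspaceT => z.
  exact/differentiable_continuous/derivable1_diffP.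
by move=> c _ ->; rewrite normrM ler_wpM2r.
Qed.

Lemma compact_support_bounded f K : continuous f ->
  (forall x, K <= `|x| -> f x = 0) -> exists M : R, forall x, `|f x| <= M.
Proof.
move=> cf f0.
have : compact (f @` `[- K, K]).
  apply: continuous_compact; last exact: segment_compact.
  exact: continuous_subspaceT.
move=> /compact_bounded [N [_ /(_ (`|N| + 1))]] H.
have {}H : forall y, (f @` `[- K, K]) y -> `|y| <= `|N| + 1.
  by apply: H; rewrite ltr_pwDr// ler_norm.
exists (`|N| + 1) => x; have [Kx|xK] := leP K `|x|.
  by rewrite f0// normr0 addr_ge0.
by apply: H; exists x => //=; rewrite in_itv/= -ler_norml ltW.
Qed.

End calculus_bounds.

Section stein_equation.
Context (R : realType) (s K L : R) (g : R -> R).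
Hypotheses (s0 : 0 < s) (K0 : 0 < K).
Hypothesis g_lip : forall x y, `|g x - g y| <= L * `|x - y|.
Hypothesis g_supp : forall x, K <= `|x| -> g x = 0.
Local Notation mu := (@lebesgue_measure R).
Local Notation p := (normal_pdf 0 s).
Hypothesis g_mean : \int[mu]_x (g x * p x) = 0.

Let cg : continuous g. Proof. exact: lipschitz_continuous g_lip. Qed.

Let cgp : continuous (fun x => g x * p x).
Proof.
by move=> x; apply: cvgM; [exact: cg|apply: continuous_normal_pdf; rewrite gt_eqF].
Qed.

Let igp : mu.-integrable setT (EFin \o (fun x => g x * p x)).
Proof.
have [M gM] := compact_support_bounded cg g_supp.
have iMp : mu.-integrable setT (fun x => (M * p x)%:E).
  under eq_fun do rewrite EFinM.
  by apply: integrableZl => //; exact: integrable_normal_pdf.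
apply: le_integrable iMp => //.
  by apply/measurable_EFinP; apply: measurable_funS (continuous_measurable_fun cgp).
move=> x _ /=; rewrite lee_fin !normrM ler_wpM2r//.
exact: le_trans (gM x) (ler_norm _).
Qed.

(* Compactly supported because g has Gaussian mean zero: no tail estimate is needed. *)
Let G x := \int[mu]_(t in `]-oo, x]) (g t * p t).

Let G_deriv (x : R) : is_derive x 1 G (g x * p x).
Proof.
have xx1 : x < x + 1 by rewrite ltrDl.
have [||] := @continuous_FTC1 R (fun t => g t * p t) -oo%O x (x + 1) xx1 _ _ (@cgp x).
- by apply: integrableS igp.
- by rewrite ltNyr.
by move=> dG <-; rewrite derive1E; exact/derivableP.
Qed.

(** Right of the support the integral is already the full one, which is zero; left of it nothing has
    been collected. *)
Let G_supp x : K <= `|x| -> G x = 0.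
Proof.
move=> Kx; have [x0|x0] := leP 0 x.
  rewrite -g_mean /G Rintegral_mkcond; apply: eq_Rintegral => t _.
  rewrite patchE; case: ifPn => //; rewrite notin_setE/= in_itv/= => /negP.
  rewrite -ltNge => xt; rewrite g_supp ?mul0r//.
  by move: Kx; rewrite !ger0_norm//; lra.
rewrite /G Rintegral_mkcond; transitivity (\int[mu]_t (0 : R)); last first.
  by rewrite Rintegral_cst// mul0r.
apply: eq_Rintegral => t _; rewrite patchE; case: ifPn => //.
rewrite inE/= in_itv/= => tx; rewrite g_supp ?mul0r//.
move: Kx; rewrite !ltr0_norm//; first lra.
exact: le_lt_trans tx x0.
Qed.

(** With [p' = - x p / s^2] the equation reads [(s^2 p f)' = g p], so [f = G / (s^2 p)]. The growth
    of [1 / p] is harmless since [G] has compact support. *)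
Lemma stein_solution : exists f df : R -> R,
  [/\ forall x : R, is_derive x 1 f (df x),
      forall x, s ^+ 2 * df x - x * f x = g x,
      exists M : R, forall x, `|f x| <= M,
      exists M : R, forall x, `|df x| <= M &
      exists M : R, forall x y, `|df x - df y| <= M * `|x - y|].
Proof.
have s2 : s ^+ 2 != 0 by rewrite sqrf_eq0 gt_eqF.
have sn0 : s != 0 by rewrite gt_eqF.
(* [c * q] is [1 / (s^2 p)], because [q * p] is the constant [normal_peak s]. *)
pose c := (s ^+ 2 * normal_peak s)^-1.
pose q x := expR (x ^+ 2 / (s ^+ 2 *+ 2)).
pose f x := c * (q x * G x).
(* Read off from the equation, which then holds by definition; that this is the derivative of [f] is
   what remains to prove. *)
pose df x := (x * f x + g x) / s ^+ 2.
have qp x : q x * p x = normal_peak s.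
  rewrite normal_pdfE// mulrCA /normal_fun subr0 /q -expRD mulNr subrr.
  by rewrite expR0 mulr1.
have q_deriv (x : R) : is_derive x 1 q (x / s ^+ 2 * q x).
  have H : is_derive x (1 : R) (id * id * cst (s ^+ 2 *+ 2)^-1 : R -> R)
      (x / s ^+ 2).
    apply: is_derive_eq; rewrite /GRing.scale/= !mulr0 add0r !mulr1 /cst.
    by rewrite -(mulr_natr (s ^+ 2)); field.
  have -> : q = expR \o (id * id * cst (s ^+ 2 *+ 2)^-1).
    by apply/funext => y; rewrite /q/= expr2.
  by apply: is_derive_eq; rewrite mulrC /q/= expr2.
have f_deriv (x : R) : is_derive x 1 f (df x).
  have -> : f = cst c * (q * G) by apply/funext.
  have dqG := @is_deriveM _ _ _ _ _ _ _ _ (q_deriv x) (G_deriv x).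
  apply: is_derive_eq; rewrite /GRing.scale/=.
  rewrite mulr0 addr0 /df /f /c -(qp x).
  have := normal_peak_gt0 sn0; rewrite -(qp x) => /lt0r_neq0.
  by rewrite mulf_eq0 negb_or => /andP[q0 p0]; field; rewrite ?q0 ?p0 ?sn0.
have f_supp x : K <= `|x| -> f x = 0 by move=> Kx; rewrite /f G_supp// !mulr0.
have [Mf fM] : exists M : R, forall x, `|f x| <= M.
  apply: compact_support_bounded f_supp => x.
  exact/differentiable_continuous/derivable1_diffP.
have Mf0 : 0 <= Mf := le_trans (normr_ge0 _) (fM 0).
have [Mg gM] := compact_support_bounded cg g_supp.
have Mg0 : 0 <= Mg := le_trans (normr_ge0 _) (gM 0).
pose N := (K * Mf + Mg) / s ^+ 2.
have dfN x : `|df x| <= N.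
  have [Kx|xK] := leP K `|x|.
    rewrite /df f_supp// g_supp// mulr0 addr0 mul0r normr0 divr_ge0 ?sqr_ge0//.
    by rewrite addr_ge0// mulr_ge0// ltW.
  rewrite /df normrM (ger0_norm (_ : 0 <= (s ^+ 2)^-1)) ?invr_ge0 ?sqr_ge0//.
  rewrite ler_wpM2r ?invr_ge0 ?sqr_ge0// (le_trans (ler_normD _ _))// lerD//.
  by rewrite normrM ler_pM// ltW.
exists f, df; split => //.
- by move=> x; rewrite /df mulrC divfK// addrAC subrr add0r.
- by exists Mf.
- by exists N.
(* [g] is only Lipschitz, so [df] is not differentiated: [x * f x] has the bounded derivative
   [f + x * df], and [g] contributes its own constant [L]. *)
have xf_lip := @is_derive_lipschitz R (fun x => x * f x) (fun x => f x + x * df x).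
exists ((Mf + K * N + L) / s ^+ 2) => x y.
rewrite /df -mulrBl normrM (ger0_norm (_ : 0 <= (s ^+ 2)^-1)) ?invr_ge0 ?sqr_ge0//.
rewrite mulrAC ler_wpM2r ?invr_ge0 ?sqr_ge0// opprD addrACA.
rewrite (le_trans (ler_normD _ _))// mulrDl lerD//; apply: xf_lip => z.
  have -> : (fun x => x * f x) = id * f by apply/funext.
  by apply: is_derive_eq; rewrite /GRing.scale/= mulr1 addrC.
rewrite (le_trans (ler_normD _ _))// lerD// normrM.
have [Kz|zK] := leP K `|z|; last by rewrite ler_pM// ltW.
rewrite /df f_supp// g_supp// mulr0 addr0 mul0r normr0 mulr0.
by rewrite mulr_ge0 ?(le_trans _ (dfN 0))// ltW.
Qed.

End stein_equation.

(** * Central limit theorem for test functions *)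

Section indep_product.
Context d (T : measurableType d) (R : realType) (P : probability T R).
Variable X : nat -> {RV P >-> R}.

Lemma bounded_mfun_sigma_cylinder J (phi : sigma_cylinder X J -> R) :
  bounded_mfun phi -> bounded_mfun (phi : T -> R).
Proof.
move=> [mphi [M phiM]]; split; last by exists M.
by move=> _ B mB; apply: (@sigma_cylinder_measurable _ _ _ _ X J); exact: mphi.
Qed.

Hypothesis X_indep : mutually_independent X.

Lemma indep_RintegralM (J : {fset nat}) (b : nat) (a : R -> R)
    (phi : sigma_cylinder X J -> R) :
  b \notin J -> bounded_mfun a -> bounded_mfun phi ->
  \int[P]_w (a (X b w) * phi w) = \int[P]_w a (X b w) * \int[P]_w phi w.
Proof.
move=> bJ ba bphi.
have bf : bounded_mfun (fun z : (R * sigma_cylinder X J)%type => a z.1 * phi z.2).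
  apply: bounded_mfunM.
    by apply: (bounded_mfun_comp _ ba); exact: measurable_fst.
  by apply: (bounded_mfun_comp _ bphi); exact: measurable_snd.
rewrite (indep_Rintegral X_indep bJ bf)/=.
rewrite -(bounded_RintegralZ P _ (bounded_mfun_sigma_cylinder bphi)).
apply: eq_Rintegral => w _; rewrite (Rintegral_distribution P (X b) ba).
by rewrite RintegralZr//; exact: bounded_mfun_integrable.
Qed.

End indep_product.

Section clt.
Context d (T : measurableType d) (R : realType) (P : probability T R).
Variable X : nat -> {RV P >-> R}.
Hypothesis X_indep : mutually_independent X.
Variables (psi : R -> R) (M s : R).
Hypotheses (mpsi : measurable_fun setT psi) (psiM : forall x, `|psi x| <= M).
Hypothesis s0 : 0 < s.
Hypothesis psi_mean : forall j, \int[P]_w psi (X j w) = 0.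
Hypothesis psi_var : forall j, \int[P]_w (psi (X j w) ^+ 2) = s ^+ 2.

Definition normalized_sum n w := (Num.sqrt n%:R)^-1 * \sum_(j < n) psi (X j w).
Local Notation W := normalized_sum.

Let bpsi : bounded_mfun psi. Proof. by split=> //; exists M. Qed.

Let bpsiX j : bounded_mfun (fun w => psi (X j w)).
Proof. by apply: (bounded_mfun_comp _ bpsi); exact: measurable_funPT. Qed.

Lemma bounded_mfun_normalized_sum n : bounded_mfun (W n).
Proof. by apply: bounded_mfunZ; apply: bounded_mfun_sum => j _; exact: bpsiX. Qed.

Lemma bounded_mfun_comp_continuous d' (S : measurableType d') (h : S -> R) (f : R -> R) :
  measurable_fun setT h -> continuous f -> (exists N, forall x, `|f x| <= N) ->
  bounded_mfun (fun x => f (h x)).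
Proof.
move=> mh cf [N fN]; split; last by exists N => x; exact: fN.
by apply: measurableT_comp => //; exact: continuous_measurable_fun.
Qed.

Section stein_estimate.
Variables (f df : R -> R) (L : R).
Hypothesis f_deriv : forall x : R, is_derive x 1 f (df x).
Hypothesis f_bounded : exists N : R, forall x, `|f x| <= N.
Hypothesis df_bounded : exists N : R, forall x, `|df x| <= N.
Hypothesis df_lip : forall x y, `|df x - df y| <= L * `|x - y|.

Let M0 : 0 <= M. Proof. exact: le_trans (normr_ge0 _) (psiM 0). Qed.
Let L0 : 0 <= L.
Proof.
by have := le_trans (normr_ge0 _) (df_lip 1 0); rewrite subr0 normr1 mulr1.
Qed.

Let f_cont : continuous f.
Proof. by move=> x; exact/differentiable_continuous/derivable1_diffP. Qed.

Let df_cont : continuous df. Proof. exact: lipschitz_continuous df_lip. Qed.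

(** A second-order bound without a second derivative: the mean value theorem gives [y * df c] with
    [c] within [|y|] of [x], and [df] is Lipschitz. *)
Let f_taylor x y : `|f (x + y) - f x - y * df x| <= L * y ^+ 2.
Proof.
have fl (a b : R) : a <= b ->
    exists2 c, c \in `[a, b]%R & f b - f a = df c * (b - a).
  move=> ab; apply: MVT_segment => //.
  by apply: continuous_subspaceT => z; exact: f_cont.
have [c cxy ->] : exists2 c, `|c - x| <= `|y| & f (x + y) - f x = y * df c.
  have [y0|y0] := leP 0 y.
    have [|c + ->] := fl x (x + y); first by rewrite lerDl.
    rewrite in_itv/= => /andP[xc cxy]; exists c; last by ring.
    by rewrite !ger0_norm//; lra.
  have [|c + E] := fl (x + y) x; first by lra.
  rewrite in_itv/= => /andP[xc cxy]; exists c.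
    by rewrite ler0_norm ?(ltr0_norm y0); lra.
  by rewrite -[LHS]opprB E; ring.
rewrite -mulrBr normrM -[y ^+ 2]real_normK ?num_real// expr2 mulrCA.
rewrite ler_wpM2l// (le_trans (df_lip _ _))// ler_wpM2l//.
Qed.

Let rest n (j : 'I_n) w := (Num.sqrt n%:R)^-1 * \sum_(k < n | k != j) psi (X k w).

Let rest_cylinder n (j : 'I_n) : exists2 J : {fset nat}, (j : nat) \notin J &
  measurable_fun setT (rest j : sigma_cylinder X J -> R).
Proof.
exists [fset k in iota 0 n | k != j]%fset.
  by rewrite !inE/= eqxx andbF.
have -> : rest j = (fun w => (Num.sqrt n%:R)^-1 *
    \sum_(k < n) (if k != j then psi (X k w) else 0)).
  by apply/funext => w; rewrite /rest big_mkcond.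
apply: measurable_funM => //; apply: measurable_sum => k; case: (boolP (k != j)) => // kj.
apply: measurableT_comp => //; apply: measurable_sigma_cylinder.
by rewrite !inE/= mem_iota/= add0n ltn_ord.
Qed.

(** Leave one out: [f (W n)] is expanded around [rest j], which is independent of [X j]. The
    zeroth-order term dies with the mean of [psi], the first-order one produces [s^2 E df], and the
    second-order one is the error. *)
Lemma stein_estimate n : (0 < n)%N ->
  `|\int[P]_w (s ^+ 2 * df (W n w) - W n w * f (W n w))| <=
  L * M * (M ^+ 2 + s ^+ 2) / Num.sqrt n%:R.
Proof.
move=> n0; set e := (Num.sqrt n%:R)^-1.
have rn0 : 0 < Num.sqrt n%:R :> R by rewrite sqrtr_gt0 ltr0n.
have e0 : 0 < e by rewrite invr_gt0.
have ne2 : n%:R * e ^+ 2 = 1.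
  by rewrite exprVn sqr_sqrtr ?ler0n// divff// pnatr_eq0 -lt0n.
have bW := bounded_mfun_normalized_sum n.
have bfW : bounded_mfun (fun w => f (W n w)).
  by apply: bounded_mfun_comp_continuous => //; case: bW.
have bdfW : bounded_mfun (fun w => df (W n w)).
  by apply: bounded_mfun_comp_continuous => //; case: bW.
(* Each summand is off by [O(1/n)]; [n] of them with the prefactor [e = 1/sqrt n] give
   [O(1/sqrt n)]. *)
have main (j : 'I_n) : `|\int[P]_w (psi (X j w) * f (W n w)) -
    e * (s ^+ 2 * \int[P]_w df (W n w))| <= e ^+ 2 * (L * M * (M ^+ 2 + s ^+ 2)).
  have [J jJ mJ] := rest_cylinder j.
  have bfJ : bounded_mfun (fun w : sigma_cylinder X J => f (rest j w)).
    exact: bounded_mfun_comp_continuous.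
  have bdfJ : bounded_mfun (fun w : sigma_cylinder X J => df (rest j w)).
    exact: bounded_mfun_comp_continuous.
  have bf := bounded_mfun_sigma_cylinder bfJ.
  have bdf := bounded_mfun_sigma_cylinder bdfJ.
  have bpsi2 : bounded_mfun (fun x => psi x ^+ 2).
    by under eq_fun do rewrite expr2; exact: bounded_mfunM.
  have bpsi2X : bounded_mfun (fun w => psi (X j w) ^+ 2).
    by apply: (bounded_mfun_comp _ bpsi2); exact: measurable_funPT.
  have Wj w : W n w = rest j w + e * psi (X j w).
    by rewrite /W (bigD1 j)//= mulrDr addrC.
  have E1 := indep_RintegralM X_indep jJ bpsi bfJ.
  have E2 := indep_RintegralM X_indep jJ bpsi2 bdfJ.
  rewrite psi_mean mul0r in E1; rewrite psi_var in E2.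
  have B1 : `|\int[P]_w (psi (X j w) * f (W n w)) -
      e * (s ^+ 2 * \int[P]_w df (rest j w))| <= e ^+ 2 * (L * M * M ^+ 2).
    rewrite -E2 -bounded_RintegralZ; last exact: bounded_mfunM.
    (* The zero that is subtracted is the mean of the zeroth-order term. *)
    rewrite -[X in `|X - _|]subr0 -E1 -!bounded_RintegralB; last first.
    - exact: bounded_mfunM.
    - exact: bounded_mfunM.
    - by apply: bounded_mfunZ; exact: bounded_mfunM.
    - by apply: bounded_mfunB; exact: bounded_mfunM.
    apply: normr_Rintegral_le => [|w].
      apply: bounded_mfunB; first by apply: bounded_mfunB; exact: bounded_mfunM.
      by apply: bounded_mfunZ; exact: bounded_mfunM.
    have -> : psi (X j w) * f (W n w) - psi (X j w) * f (rest j w) -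
        e * (psi (X j w) ^+ 2 * df (rest j w)) = psi (X j w) *
        (f (rest j w + e * psi (X j w)) - f (rest j w) -
         e * psi (X j w) * df (rest j w)) by rewrite Wj; ring.
    rewrite normrM (@le_trans _ _ (M * (L * (e * psi (X j w)) ^+ 2)))//.
      by rewrite ler_pM// f_taylor.
    rewrite [leRHS](_ : _ = M * (L * (e * M) ^+ 2)); last by ring.
    rewrite ler_wpM2l// ler_wpM2l// -real_normK ?num_real// ler_sqr ?nnegrE//; last first.
      by rewrite mulr_ge0// ltW.
    by rewrite normrM (gtr0_norm e0) ler_wpM2l// ltW.
  (* The cost of putting the left-out summand back inside [df]. *)
  have B2 : `|\int[P]_w df (rest j w) - \int[P]_w df (W n w)| <= e * (L * M).
    rewrite -bounded_RintegralB//.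
    apply: normr_Rintegral_le => [|w]; first exact: bounded_mfunB.
    rewrite (le_trans (df_lip _ _))// mulrCA ler_wpM2l// Wj opprD addNKr normrN.
    by rewrite normrM (gtr0_norm e0) ler_wpM2l// ltW.
  rewrite -(subrKA (e * (s ^+ 2 * \int[P]_w df (rest j w)))).
  rewrite (le_trans (ler_normD _ _))// [leRHS](_ : _ = e ^+ 2 * (L * M * M ^+ 2) +
    e * (s ^+ 2 * (e * (L * M)))); last by ring.
  rewrite lerD// -!mulrBr normrM (gtr0_norm e0) ler_wpM2l// ?(ltW e0)//.
  by rewrite normrM ger0_norm ?sqr_ge0// ler_wpM2l// sqr_ge0.
rewrite bounded_RintegralB; last exact: bounded_mfunM.
  2: exact: bounded_mfunZ.
have -> : \int[P]_w (W n w * f (W n w)) =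
    e * \sum_(j < n) \int[P]_w (psi (X j w) * f (W n w)).
  rewrite -bounded_Rintegral_sum; last by move=> j _; exact: bounded_mfunM.
  rewrite -bounded_RintegralZ; last first.
    by apply: bounded_mfun_sum => j _; exact: bounded_mfunM.
  by apply: eq_Rintegral => w _; rewrite -mulr_suml mulrA.
rewrite bounded_RintegralZ//.
(* By [n * e^2 = 1] this term becomes a sum over [j], to be compared with the other one term by
   term. *)
have -> : s ^+ 2 * \int[P]_w df (W n w) =
    e * \sum_(j < n) e * (s ^+ 2 * \int[P]_w df (W n w)).
  by rewrite sumr_const card_ord -mulr_natl !mulrA [e * _]mulrC -[_ * e * e]mulrA -expr2 ne2 mul1r.
rewrite -mulrBr -sumrB normrM (gtr0_norm e0) -/e [leRHS]mulrC ler_wpM2l// ?(ltW e0)//.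
rewrite (le_trans (ler_norm_sum _ _ _))//.
apply: (@le_trans _ _ (\sum_(j < n) e ^+ 2 * (L * M * (M ^+ 2 + s ^+ 2)))).
  by apply: ler_sum => j _; rewrite distrC main.
by rewrite sumr_const card_ord -mulr_natl mulrA ne2 mul1r.
Qed.

End stein_estimate.

Lemma clt_test_function (K L : R) (g : R -> R) : 0 < K ->
  (forall x y, `|g x - g y| <= L * `|x - y|) ->
  (forall x, K <= `|x| -> g x = 0) ->
  \int[lebesgue_measure]_x (g x * normal_pdf 0 s x) = 0 ->
  exists C, forall n, (0 < n)%N ->
    `|\int[P]_w g (W n w)| <= C / Num.sqrt n%:R.
Proof.
move=> K0 g_lip g_supp g_mean.
have [f [df [f_deriv fE fM dfM [N dfN]]]] := stein_solution s0 K0 g_lip g_supp g_mean.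
exists (N * M * (M ^+ 2 + s ^+ 2)) => n n0.
under eq_Rintegral do rewrite -fE.
exact: (stein_estimate f_deriv fM dfM dfN n0).
Qed.

End clt.

(** * From test functions to distribution functions *)

Definition normal_mean (R : realType) (s : R) (f : R -> R) : R :=
  \int[lebesgue_measure]_y (f y * normal_pdf 0 s y).

Section unit_interval_arithmetic.
Context (R : realFieldType).

(** The arithmetic of [ramp_limit], with the integrals abstracted: [A] and [B] are values of the
    normal distribution function, [Nb] the Gaussian mean of the bump, [c] the recentring factor, and
    [u], [h], [r] the means under [V] of bump, product and ramp. *)
Lemma recentring_bounds (A B t Nb c u h r : R) : 0 < t ->
  1 - 2 * t <= Nb <= 1 -> 0 <= c <= 1 -> A - 2 * t <= c * Nb <= B ->
  1 - t <= u <= 1 -> - t <= h - c * u <= t -> h <= r <= h + t ->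
  A - 4 * t <= r <= B + 4 * t.
Proof.
move=> t0 /andP[N1 N2] /andP[c0 c1] /andP[A1 B1] /andP[u0 u1] /andP[h0 h1] /andP[r0 r1].
have cN : c - c * Nb <= 2 * t by nra.
have cN' : c * Nb <= c by nra.
have cu : c - t <= c * u by nra.
have cu' : c * u <= c by nra.
by apply/andP; split; lra.
Qed.

Lemma unit_interval_mul_le (a b : R) : 0 <= a <= 1 -> 0 <= b <= 1 ->
  [/\ a * b <= a, a * b <= b & a <= a * b + (1 - b)].
Proof. by move=> /andP[a0 a1] /andP[b0 b1]; split; nra. Qed.

End unit_interval_arithmetic.

Section slutsky_normal.
Context d (T : measurableType d) (R : realType) (P : probability T R) (s : R).
Local Notation mu := (@lebesgue_measure R).
Local Notation p := (normal_pdf 0 s).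
Local Notation N := (normal_mean s).

Let integrable_Mp (f : R -> R) : bounded_mfun f ->
  mu.-integrable setT (EFin \o (fun y => f y * p y)).
Proof.
move=> [mf [M fM]].
have iMp : mu.-integrable setT (fun x => (M * p x)%:E).
  under eq_fun do rewrite EFinM.
  by apply: integrableZl => //; exact: integrable_normal_pdf.
apply: le_integrable iMp => //.
  by apply/measurable_EFinP/measurable_funM => //; exact: measurable_normal_pdf.
move=> x _ /=; rewrite lee_fin !normrM ler_wpM2r//.
exact: le_trans (fM x) (ler_norm _).
Qed.

Let N_le (f g : R -> R) : bounded_mfun f -> bounded_mfun g -> (forall x, f x <= g x) ->
  N f <= N g.
Proof.
move=> bf bg fg; rewrite /normal_mean; apply: le_Rintegral => //; [exact: integrable_Mp..|].
by move=> x _; rewrite ler_wpM2r// normal_pdf_ge0.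
Qed.

Let N_B (f g : R -> R) : bounded_mfun f -> bounded_mfun g ->
  N (fun x => f x - g x) = N f - N g.
Proof.
move=> bf bg; rewrite /normal_mean -RintegralB//; [|exact: integrable_Mp..].
by under eq_Rintegral do rewrite mulrBl.
Qed.

Let N_Z c (f : R -> R) : bounded_mfun f -> N (fun x => c * f x) = c * N f.
Proof.
move=> bf; rewrite /normal_mean -RintegralZl//; last exact: integrable_Mp.
by under eq_Rintegral do rewrite -mulrA.
Qed.

Let N_indic (A : set R) : measurable A -> N \1_A = fine (normal_prob 0 s A).
Proof.
move=> mA; rewrite /normal_mean /normal_prob [in RHS]integral_mkcond /Rintegral; congr fine.
apply: eq_integral => y _; rewrite restrict_EFin/= patchE indicE.
by case: ifP => _; rewrite ?mul1r ?mul0r.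
Qed.

Let N1 : N (fun=> 1) = 1.
Proof.
rewrite /normal_mean; under eq_Rintegral do rewrite mul1r.
by rewrite /Rintegral integral_normal_pdf.
Qed.

Local Notation Phi x := (fine (normal_prob 0 s `]-oo, x%R])).

(** The identity, as a random variable under the normal law, has distribution function [Phi]; the
    limits of a [cdf] at both infinities then apply to [Phi]. *)
Let idR : measurableTypeR R -> R := idfun.

#[local] HB.instance Definition _ :=
  @isMeasurableFun.Build _ _ _ _ idR (@measurable_id _ _ setT).

Let Phi_tail e : 0 < e ->
  exists K0, forall K, K0 <= K -> 1 - e <= Phi K /\ Phi (- K) <= e.
Proof.
move=> e0; pose Q : probability (measurableTypeR R) R := normal_prob 0 s.
have /fine_cvgP[_ /cvgrPdist_le/(_ e e0)] := @cvg_cdfy1 _ _ _ Q idR.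
have /fine_cvgP[_ /cvgrPdist_le/(_ e e0)] := @cvg_cdfNy0 _ _ _ Q idR.
move=> [A [_ HA]] [B [_ HB]].
exists (Num.max (1 - A) (B + 1)) => K; rewrite ge_max => /andP[AK BK]; split.
  have BK1 : B < K by rewrite (lt_le_trans _ BK)// ltrDl.
  have : `|1 - Phi K| <= e := HB K BK1.
  by rewrite ler_distlC => /andP[].
have AK1 : - K < A by lra.
have : `|0 - Phi (- K)| <= e := HA (- K) AK1.
by rewrite sub0r normrN ger0_norm// fine_ge0.
Qed.

(** A Lipschitz substitute for the indicator of []-oo, a]], falling from 1 to 0 between [a] and
    [a + e]. Its support is unbounded, hence the factor [bump], which is 1 on [[-K, K]] and 0 from
    distance [K + 1] on. *)
Let ramp (a e y : R) := Num.min 1 (Num.max 0 ((a + e - y) / e)).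
Let bump (K y : R) := Num.min 1 (Num.max 0 (K + 1 - `|y|)).

Let clip_spec (u : R) : let c := Num.min 1 (Num.max 0 u) in
  [\/ u <= 0 /\ c = 0, 0 <= u <= 1 /\ c = u | 1 <= u /\ c = 1].
Proof.
have [u0|u0] /= := leP u 0.
  by apply: Or31; rewrite min_r//.
have [u1|u1] := leP u 1; first by apply: Or32; rewrite ltW.
by apply: Or33; rewrite ltW.
Qed.

Let clip_lip (u v : R) : `|Num.min 1 (Num.max 0 u) - Num.min 1 (Num.max 0 v)| <= `|u - v|.
Proof.
wlog uv : u v / u <= v.
  by move=> H; have /orP[/H//|/H] := le_total u v; rewrite distrC (distrC u).
have := clip_spec u; have := clip_spec v => /=.
move: (Num.min 1 (Num.max 0 u)) (Num.min 1 (Num.max 0 v)) => a b Hb Ha.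
have ab : a <= b by case: Ha => -[? ->]; case: Hb => -[? ->]; lra.
rewrite !ler0_norm ?subr_le0//.
by case: Ha => -[? ->]; case: Hb => -[? ->]; lra.
Qed.

Let clip01 (u : R) : 0 <= Num.min 1 (Num.max 0 u) <= 1.
Proof. by case: (clip_spec u) => -[? ->]; lra. Qed.

Let ramp01 a e y : 0 <= ramp a e y <= 1. Proof. exact: clip01. Qed.
Let bump01 K y : 0 <= bump K y <= 1. Proof. exact: clip01. Qed.

Let ramp_lip a e : 0 < e -> forall x y, `|ramp a e x - ramp a e y| <= e^-1 * `|x - y|.
Proof.
move=> e0 x y; rewrite (le_trans (clip_lip _ _))//.
rewrite -mulrBl opprB addrC subrKA normrM mulrC distrC ler_wpM2r//.
by rewrite ger0_norm// invr_ge0 ltW.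
Qed.

Let bump_lip K x y : `|bump K x - bump K y| <= 1 * `|x - y|.
Proof.
rewrite mul1r (le_trans (clip_lip _ _))// opprB addrC subrKA.
by rewrite distrC ler_dist_dist.
Qed.

Let ramp_ge a e y : 0 < e -> \1_`]-oo, a] y <= ramp a e y.
Proof.
move=> e0; rewrite indicE; case: (boolP (y \in _)); last by case/andP: (ramp01 a e y).
rewrite inE/= in_itv/= => ya; rewrite /ramp le_min lexx le_max/=.
by rewrite ler_pdivlMr// mul1r addrAC lerDr subr_ge0 ya orbT.
Qed.

Let ramp_le a e y : 0 < e -> ramp a e y <= \1_`]-oo, a + e] y.
Proof.
move=> e0; rewrite indicE; case: (boolP (y \in _)); first by case/andP: (ramp01 a e y).
rewrite notin_setE/= in_itv/= => /negP; rewrite -ltNge => ya.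
by rewrite /ramp ge_min ge_max lexx/= pmulr_lle0 ?invr_gt0// subr_le0 (ltW ya) orbT.
Qed.

(** The lower bound is written with rays so that its Gaussian mean is [Phi K - Phi (- K)]. *)
Let bump_ge K y : \1_`]-oo, K] y - \1_`]-oo, - K] y <= bump K y.
Proof.
rewrite !indicE; have [h1|_] := boolP (y \in `]-oo, K]%classic); last first.
  by have := bump01 K y; case: (_ \in _) => /=; lra.
have [_|h2] := boolP (y \in `]-oo, - K]%classic).
  by have := bump01 K y; rewrite /=; lra.
move: h1 h2; rewrite inE notin_setE/= !in_itv/= => yK /negP; rewrite -ltNge => Ky.
have : `|y| <= K by rewrite ler_norml yK ltW.
by move=> yK'; rewrite /bump; case: (clip_spec (K + 1 - `|y|)) => -[? ->]; lra.
Qed.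

(** Chebyshev's inequality before integration. *)
Let bump_tail K y : 0 < K -> 1 - bump K y <= y ^+ 2 / K ^+ 2.
Proof.
move=> K0; have [yK|Ky] := leP `|y| K.
  have -> : bump K y = 1.
    by rewrite /bump; apply/min_idPl; rewrite le_max; apply/orP; right; lra.
  by rewrite subrr divr_ge0 ?sqr_ge0.
rewrite (@le_trans _ _ 1)//; first by have := bump01 K y; lra.
rewrite ler_pdivlMr ?exprn_gt0// mul1r -(real_normK (num_real y)) ler_sqr ?nnegrE ?ltW//.
exact: lt_trans Ky.
Qed.

Let bump_supp K y : K + 1 <= `|y| -> bump K y = 0.
Proof.
by move=> Ky; rewrite /bump; case: (clip_spec (K + 1 - `|y|)) => -[? ->]; lra.
Qed.

Let bounded_mfun_lip (f : R -> R) (L : R) : (forall x, 0 <= f x <= 1) ->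
  (forall x y : R, `|f x - f y| <= L * `|x - y|) -> @bounded_mfun _ R R f.
Proof.
move=> f01 fL; split.
  exact: continuous_measurable_fun (lipschitz_continuous fL).
by exists 1 => x; have := f01 x; rewrite ler_norml; lra.
Qed.

Let bb K : bounded_mfun (bump K).
Proof. by apply: (@bounded_mfun_lip _ 1) => *; [exact: bump01|exact: bump_lip]. Qed.

Let br a e : 0 < e -> bounded_mfun (ramp a e).
Proof.
by move=> e0; apply: (@bounded_mfun_lip _ e^-1) => *; [exact: ramp01|exact: ramp_lip].
Qed.

Let mray (a : R) : bounded_mfun (\1_`]-oo, a] : R -> R).
Proof. exact: bounded_mfun_indic. Qed.

Variables V W : nat -> T -> R.
Hypothesis bV : forall n, bounded_mfun (V n).
Hypothesis bW : forall n, bounded_mfun (W n).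
Hypothesis W_test : forall (K L : R) (g : R -> R), 0 < K ->
  (forall x y, `|g x - g y| <= L * `|x - y|) ->
  (forall x, K <= `|x| -> g x = 0) ->
  N g = 0 -> \int[P]_w g (W n w) @[n --> \oo] --> 0.
Hypothesis W_var : forall n, \int[P]_w (W n w ^+ 2) <= s ^+ 2.
Hypothesis VW : \int[P]_w ((V n w - W n w) ^+ 2) @[n --> \oo] --> 0.

Let bcompV (f : R -> R) n : bounded_mfun f -> bounded_mfun (fun w => f (V n w)).
Proof. by case: (bV n) => mV _ bf; exact: (bounded_mfun_comp mV bf). Qed.

Let bcompW (f : R -> R) n : bounded_mfun f -> bounded_mfun (fun w => f (W n w)).
Proof. by case: (bW n) => mW _ bf; exact: (bounded_mfun_comp mW bf). Qed.

Let bsq d' (S : measurableType d') (f : S -> R) : bounded_mfun f ->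
  bounded_mfun (fun w => f w ^+ 2).
Proof. by move=> bf; under eq_fun do rewrite expr2; exact: bounded_mfunM. Qed.

(** From [W] to [V]: [|g V - g W| <= L |V - W|], and [|y| <= t + y^2 / t] turns the first moment
    into the second one, which is known to vanish. *)
Let V_test (K L : R) (g : R -> R) : 0 < K -> @bounded_mfun _ R R g ->
  (forall x y, `|g x - g y| <= L * `|x - y|) ->
  (forall x, K <= `|x| -> g x = 0) ->
  N g = 0 -> forall e, 0 < e -> \forall n \near \oo, `|\int[P]_w g (V n w)| <= e.
Proof.
move=> K0 bg gL gK g0 e e0.
have L0 : 0 <= L.
  by have := le_trans (normr_ge0 _) (gL 1 0); rewrite subr0 normr1 mulr1.
(* Chosen so that [L * t <= e / 3]; a second moment below [t * t] then makes the total at most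
   [L * (t + t) + e / 3 <= e]. *)
pose t := e / (3 * (L + 1)).
have t0 : 0 < t by rewrite divr_gt0// mulr_gt0// ltr_wpDl.
have /cvgrPdist_le/(_ (e / 3)) C1 := W_test K0 gL gK g0.
have /cvgrPdist_le/(_ (t * t)) C2 := VW.
near=> n.
have H1 : `|\int[P]_w g (W n w)| <= e / 3.
  by rewrite -normrN -sub0r; near: n; apply: C1; rewrite divr_gt0.
have H2 : \int[P]_w ((V n w - W n w) ^+ 2) <= t * t.
  rewrite (le_trans (ler_norm _))// -normrN -sub0r; near: n; apply: C2.
  by rewrite mulr_gt0.
have bVW := bounded_mfunB (bV n) (bW n).
have : `|\int[P]_w g (V n w) - \int[P]_w g (W n w)| <= L * (t + t).
  rewrite -bounded_RintegralB; [|exact: bcompV|exact: bcompW].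
  have b1 : bounded_mfun (fun w => g (V n w) - g (W n w)).
    by apply: bounded_mfunB; [exact: bcompV|exact: bcompW].
  have b2 : bounded_mfun (fun w => t + t^-1 * (V n w - W n w) ^+ 2).
    apply: bounded_mfunD; first exact: bounded_mfun_cst.
    by apply: bounded_mfunZ; exact: bsq.
  rewrite (le_trans (bounded_le_normr_Rintegral _ b1))//.
  apply: (@le_trans _ _ (\int[P]_w (L * (t + t^-1 * (V n w - W n w) ^+ 2)))).
    apply: bounded_le_Rintegral; [exact: bounded_mfun_norm|exact: bounded_mfunZ|].
    move=> w; rewrite (le_trans (gL _ _))// ler_wpM2l//.
    set y := V n w - W n w.
    have [yt|ty] := leP `|y| t.
      by rewrite (le_trans yt)// lerDl mulr_ge0 ?sqr_ge0// invr_ge0 ltW.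
    rewrite (@le_trans _ _ (t^-1 * y ^+ 2))//; last by rewrite lerDr ltW.
    by rewrite mulrC ler_pdivlMr// -(real_normK (num_real y)) expr2 ler_wpM2l// ltW.
  rewrite bounded_RintegralZ// ler_wpM2l// bounded_RintegralD; last 2 first.
  - exact: bounded_mfun_cst.
  - by apply: bounded_mfunZ; exact: bsq.
  rewrite Rintegral_prob_cst lerD2l bounded_RintegralZ; last exact: bsq.
  by rewrite mulrC ler_pdivrMr.
have Lt : L * t <= e / 3.
  rewrite /t mulrCA ler_wpM2l// ?(ltW e0)// invfM mulrCA ler_piMr//.
  by rewrite ler_pdivrMr ?mul1r ?lerDl// ltr_wpDl.
move=> H3; rewrite -[X in `|X|](subrK (\int[P]_w g (W n w))).
by rewrite (le_trans (ler_normD _ _))//; move: H3; rewrite mulrDr; lra.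
Unshelve. all: by end_near. Qed.

(** Tightness of [V], for use in Chebyshev's inequality; the constant comes from
    [V^2 <= 2 W^2 + 2 (V - W)^2], the last square having mean at most 1 eventually. *)
Let V_moment : \forall n \near \oo, \int[P]_w (V n w ^+ 2) <= 2 * s ^+ 2 + 2.
Proof.
have /cvgrPdist_le/(_ 1 ltr01) C1 := VW; near=> n.
have H : \int[P]_w ((V n w - W n w) ^+ 2) <= 1.
  by rewrite (le_trans (ler_norm _))// -normrN -sub0r; near: n; exact: C1.
have bVW := bsq (bounded_mfunB (bV n) (bW n)).
have bW2 := bsq (bW n).
apply: (@le_trans _ _
    (\int[P]_w (2 * W n w ^+ 2 + 2 * (V n w - W n w) ^+ 2))).
  apply: bounded_le_Rintegral; first exact: bsq.
    by apply: bounded_mfunD; exact: bounded_mfunZ.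
  move=> w; rewrite -subr_ge0.
  have -> : 2 * W n w ^+ 2 + 2 * (V n w - W n w) ^+ 2 - V n w ^+ 2 =
    (2 * W n w - V n w) ^+ 2 by ring.
  exact: sqr_ge0.
rewrite bounded_RintegralD; [|exact: bounded_mfunZ..].
rewrite !bounded_RintegralZ// lerD//; first by rewrite ler_wpM2l.
by rewrite -[leRHS]mulr1 ler_wpM2l.
Unshelve. all: by end_near. Qed.

Let ramp_limit a e t : 0 < e -> 0 < t -> t <= 4^-1 ->
  \forall n \near \oo,
    Phi a - 4 * t <= \int[P]_w ramp a e (V n w) <= Phi (a + e) + 4 * t.
Proof.
move=> e0 t0 t4; set r := ramp a e.
(* With b a wide bump and c = N (ramp * b) / N b, the function ramp * b - c b has
   Gaussian mean zero, and c is close to N ramp. *)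
have [K0 HK0] := Phi_tail t0.
pose B := 2 * s ^+ 2 + 2.
have B0 : 0 < B by rewrite /B ltr_wpDl// mulr_ge0// sqr_ge0.
(* [K0] controls the Gaussian tails; [B / t] together with [K >= 1] gives [B / K^2 <= t], the
   Chebyshev error. *)
pose K := Num.max K0 (Num.max 1 (B / t)).
have [K0K K1 KB] : [/\ K0 <= K, 1 <= K & B / t <= K].
  by split; rewrite /K !le_max lexx ?orbT.
have [HK HNK] := HK0 K K0K.
have Kgt0 : 0 < K by lra.
have BK : B / K ^+ 2 <= t.
  rewrite ler_pdivrMr ?exprn_gt0// mulrC -ler_pdivrMr//.
  by rewrite (le_trans KB)// expr2 ler_peMl// ltW.
pose b := bump K; pose h y := r y * b y.
have r01 y : 0 <= r y <= 1 := ramp01 a e y.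
have b01 y : 0 <= b y <= 1 := bump01 K y.
have bh : bounded_mfun h by apply: bounded_mfunM; [exact: br|exact: bb].
have bC : bounded_mfun (fun y => 1 - b y).
  by apply: bounded_mfunB; [exact: bounded_mfun_cst|exact: bb].
have Nb_ge : 1 - 2 * t <= N b.
  apply: (@le_trans _ _ (Phi K - Phi (- K))); first lra.
  rewrite -!N_indic// -N_B//; apply: N_le; [|exact: bb|exact: bump_ge].
  exact: bounded_mfunB.
have Nb_le : N b <= 1.
  rewrite -N1; apply: N_le; [exact: bb|exact: bounded_mfun_cst|].
  by move=> y; case/andP: (b01 y).
(* Here [t <= 1/4] matters: it keeps [1 - 2 * t] positive, so that division by [N b] is
   legitimate. *)
have Nb0 : 0 < N b by lra.
have Nh_le : N h <= Phi (a + e).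
  rewrite -N_indic//; apply: N_le => // y.
  apply: le_trans (ramp_le a y e0); rewrite /h.
  by rewrite ler_piMr//; [case/andP: (r01 y)|case/andP: (b01 y)].
have Nh_leb : N h <= N b.
  apply: N_le => //; first exact: bb.
  by move=> y; case: (unit_interval_mul_le (r01 y) (b01 y)).
have Nh_ge0 : 0 <= N h.
  rewrite /normal_mean; apply: Rintegral_ge0 => y _; rewrite !mulr_ge0 ?normal_pdf_ge0//.
    by case/andP: (r01 y).
  by case/andP: (b01 y).
have Nh_ge : Phi a - 2 * t <= N h.
  apply: (@le_trans _ _ (Phi a - (1 - N b))); first lra.
  rewrite -N_indic// -[in leLHS]N1 -!N_B//; [|exact: bounded_mfun_cst|exact: bb].
  apply: N_le => //; first exact: bounded_mfunB.
  move=> y; rewrite lerBlDr; case: (unit_interval_mul_le (r01 y) (b01 y)) => _ _.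
  exact: le_trans (ramp_ge a y e0).
pose c := N h / N b.
have cNb : c * N b = N h by rewrite divfK// gt_eqF.
have c0 : 0 <= c by rewrite divr_ge0// ltW.
have c1 : c <= 1 by rewrite ler_pdivrMr// mul1r.
pose g y := h y - c * b y.
have bg : bounded_mfun g by apply: bounded_mfunB => //; apply: bounded_mfunZ; exact: bb.
have gN : N g = 0.
  rewrite /g N_B//; last by apply: bounded_mfunZ; exact: bb.
  by rewrite N_Z ?cNb ?subrr//; exact: bb.
have g_lip x y : `|g x - g y| <= (e^-1 + 1 + c * 1) * `|x - y|.
  have -> : g x - g y = (r x - r y) * b x + (b x - b y) * r y - c * (b x - b y).
    by rewrite /g /h; ring.
  rewrite (le_trans (ler_normB _ _))// [leRHS]mulrDl [X in _ <= X + _]mulrDl lerD//; last first.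
    by rewrite normrM (ger0_norm c0) -[leRHS]mulrA (ler_wpM2l c0)// bump_lip.
  rewrite (le_trans (ler_normD _ _))// !normrM lerD//.
    rewrite (le_trans _ (ramp_lip a e0 x y))// ler_piMr//.
    by case/andP: (b01 x) => ? ?; rewrite ger0_norm.
  rewrite (le_trans _ (bump_lip K x y))// ler_piMr//.
  by case/andP: (r01 y) => ? ?; rewrite ger0_norm.
have g_supp y : K + 1 <= `|y| -> g y = 0.
  by move=> Ky; rewrite /g /h /b bump_supp// !mulr0 subrr.
have K10 : 0 < K + 1 by rewrite addr_gt0.
have Hg := V_test K10 bg g_lip g_supp gN t0.
near=> n.
have : `|\int[P]_w g (V n w)| <= t by near: n; exact: Hg.
have HV : \int[P]_w (V n w ^+ 2) <= B by near: n; exact: V_moment.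
have bhV : bounded_mfun (fun w => h (V n w)) by exact: bcompV.
have bbV : bounded_mfun (fun w => b (V n w)) by apply: bcompV => //; exact: bb.
have bCV : bounded_mfun (fun w => 1 - b (V n w)) by exact: bcompV bC.
have brV : bounded_mfun (fun w => r (V n w)) by apply: bcompV => //; exact: br.
rewrite bounded_RintegralB//; last exact: bounded_mfunZ.
rewrite bounded_RintegralZ// ler_norml.
have Eb : \int[P]_w (1 - b (V n w)) <= t.
  apply: (le_trans _ BK); rewrite ler_pdivlMr ?exprn_gt0// mulrC.
  rewrite -bounded_RintegralZ// (le_trans _ HV)//.
  apply: bounded_le_Rintegral; [exact: bounded_mfunZ|exact: bsq|].
  move=> w; rewrite mulrC -ler_pdivlMr ?exprn_gt0//; exact: bump_tail.
have Ehr : \int[P]_w h (V n w) <= \int[P]_w r (V n w).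
  apply: bounded_le_Rintegral => // w.
  by case: (unit_interval_mul_le (r01 (V n w)) (b01 (V n w))).
have Erh : \int[P]_w r (V n w) <= \int[P]_w h (V n w) + \int[P]_w (1 - b (V n w)).
  rewrite -bounded_RintegralD//; apply: bounded_le_Rintegral => //.
    exact: bounded_mfunD.
  by move=> w; case: (unit_interval_mul_le (r01 (V n w)) (b01 (V n w))).
have Eb1 : \int[P]_w b (V n w) <= 1.
  rewrite -[leRHS](@Rintegral_prob_cst _ _ _ P 1).
  apply: bounded_le_Rintegral => //; first exact: bounded_mfun_cst.
  by move=> w; case/andP: (b01 (V n w)).
have Eb0 : 1 - t <= \int[P]_w b (V n w).
  move: Eb; rewrite bounded_RintegralB//; last exact: bounded_mfun_cst.
  by rewrite Rintegral_prob_cst lerBlDr addrC -lerBlDr.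
move=> Hg'; apply: (@recentring_bounds _ _ _ _ (N b) c (\int[P]_w b (V n w))
  (\int[P]_w h (V n w)) _ t0) => //.
- by rewrite Nb_ge Nb_le.
- by rewrite c0 c1.
- by rewrite cNb Nh_ge Nh_le.
- by rewrite Eb0 Eb1.
- by rewrite Ehr (le_trans Erh)// lerD2l.
Unshelve. all: by end_near. Qed.

(** The indicator of []-oo, x]] lies between the ramps that start at [x - u] and at [x]; continuity
    of [Phi] at [x] closes the gap between their limits. *)
Lemma slutsky_normal_cdf x :
  {for x, continuous (fun y : R => normal_prob 0 s `]-oo, y])} ->
  P (V n @^-1` `]-oo, x]) @[n --> \oo] --> normal_prob 0 s `]-oo, x].
Proof.
move=> cx.
have mVx n : measurable (V n @^-1` `]-oo, x]).
  by rewrite -[_ @^-1` _]setTI; case: (bV n) => + _; apply.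
have finN y : normal_prob 0 s `]-oo, y] \is a fin_num by rewrite fin_num_measure.
have {}cx : (fun y => Phi y) y @[y --> x] --> Phi x.
  have H : (fun y : R => normal_prob 0 s `]-oo, y]) y @[y --> x] --> (Phi x)%:E.
    by rewrite fineK.
  by case/fine_cvgP: H.
rewrite -[X in _ --> X]fineK//; apply/fine_cvgP; split.
  by near=> n; rewrite fin_num_measure.
apply/cvgrPdist_le => e e0.
(* [4 * t <= e / 2] uses half of the tolerance, continuity of [Phi] the other half; [1/4] is the
   bound that [ramp_limit] asks for. *)
pose t := Num.min (e / 8) 4^-1.
have t0 : 0 < t by rewrite lt_min divr_gt0//= invr_gt0.
have te : t <= e / 8 by rewrite ge_min lexx.
have t4 : t <= 4^-1 by rewrite ge_min lexx orbT.
have e20 : 0 < e / 2 by rewrite divr_gt0.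
move/cvgrPdist_le: cx => /(_ _ e20) /nbhs_ballP[D /= D0 HD].
pose u := D / 2.
have u0 : 0 < u by rewrite divr_gt0.
have uD : u < D by rewrite /u ltr_pdivrMr// ltr_pMr// ltr1n.
have Hp : `|Phi x - Phi (x + u)| <= e / 2.
  by apply: HD; rewrite /ball/= opprD addNKr normrN gtr0_norm.
have Hm : `|Phi x - Phi (x - u)| <= e / 2.
  by apply: HD; rewrite /ball/= opprB addrC subrK gtr0_norm.
near=> n.
have /andP[_ H1] : Phi x - 4 * t <= \int[P]_w ramp x u (V n w) <= Phi (x + u) + 4 * t.
  by near: n; exact: ramp_limit.
have /andP[H2 _] : Phi (x - u) - 4 * t <= \int[P]_w ramp (x - u) u (V n w) <=
    Phi (x - u + u) + 4 * t.
  by near: n; exact: ramp_limit.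
have E : fine (P (V n @^-1` `]-oo, x])) = \int[P]_w (\1_`]-oo, x] (V n w) : R).
  apply: EFin_inj; rewrite fineK ?fin_num_measure// -(Rintegral_indic_prob P (mVx n)).
  by [].
have L1 : fine (P (V n @^-1` `]-oo, x])) <= \int[P]_w ramp x u (V n w).
  rewrite E; apply: bounded_le_Rintegral => [||w]; last exact: ramp_ge.
    exact: bcompV.
  by apply: bcompV => //; exact: br.
have L2 : \int[P]_w ramp (x - u) u (V n w) <= fine (P (V n @^-1` `]-oo, x])).
  rewrite E; apply: bounded_le_Rintegral => [||w].
  - by apply: bcompV => //; exact: br.
  - exact: bcompV.
  - by rewrite (le_trans (ramp_le _ _ u0))// subrK.
move: Hp Hm; rewrite !ler_distlC => /andP[_ Hp] /andP[Hm _].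
rewrite /=; lra.
Unshelve. all: by end_near. Qed.

End slutsky_normal.

(** * Integrals over the unit interval *)

Lemma bounded_mfun_integrable_itv (R : realType) (a b : R) (f : R -> R) :
  bounded_mfun f -> lebesgue_measure.-integrable `[a, b] (EFin \o f).
Proof.
move=> [mf [M fM]]; apply: measurable_bounded_integrable => //.
- by rewrite /= lebesgue_measure_itv/=; case: ifP; rewrite ?ltry// -EFinD ltry.
- exact: measurable_funTS.
- by exists M; split; rewrite ?num_real// => y My x _ /=; exact: le_trans (fM x) (ltW My).
Qed.

Section uniform_law.
Context d (T : measurableType d) (R : realType) (P : probability T R).
Variable U : {RV P >-> R}.
Local Notation mu := (@lebesgue_measure R).
Hypothesis U01 : forall w, 0 < U w < 1.
Hypothesis U_cdf : forall x : R, 0 < x < 1 -> cdf U x = x%:E.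

(** Rays []x, +oo[] determine the law. [U_cdf] speaks of interior points only; for other [x] the
    range of [U] decides. *)
Lemma uniform_distribution (A : set R) : measurable A ->
  distribution P U A = uniform_prob (@ltr01 R) A.
Proof.
(* [U'] below is [U] with codomain [measurableTypeR R], the space on which [uniform_prob] lives. *)
move=> mA; have mU : measurable_fun setT (U : T -> measurableTypeR R).
  by move=> mT B mB; exact: (@measurable_funPT _ _ _ _ U mT B mB).
pose U' : {mfun T >-> measurableTypeR R} :=
  MeasurableFun.Pack (MeasurableFun.Class
    (isMeasurableFun.Build _ _ T (measurableTypeR R) (U : T -> measurableTypeR R) mU)).
pose Q : probability (measurableTypeR R) R := uniform_prob (@ltr01 R).
apply: (@measure_unique _ R (measurableTypeR R) (@RGenOInfty.G R)
  (fun n => `]- n%:R, +oo[%classic) _ _ _ _ (distribution P U') Q) => //.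
- exact: RGenOInfty.measurableE.
- move=> _ _ [x ->] [y ->]; exists (Num.max x y).
  by apply/seteqP; split => z /=; rewrite !in_itv/= !andbT gt_max => /andP.
- by move=> i; exists (- i%:R).
- apply/seteqP; split => // x _; exists (Num.bound `|x|) => //=.
  rewrite in_itv/= andbT ltrNl; apply: le_lt_trans (archi_boundP (normr_ge0 x)).
  by rewrite -normrN ler_norm.
- move=> _ [x ->].
  suff : distribution P U `]x, +oo[ = uniform_prob (@ltr01 R) `]x, +oo[ by [].
  have [x0|x0] := ltP x 0.
    rewrite /uniform_prob (integral_uniform_pdf1 (@ltr01 R)); last first.
      by move=> y /=; rewrite !in_itv/= andbT => /andP[y0 _]; exact: lt_le_trans y0.
    transitivity (P setT); last exact: probability_setT.
    congr (P _); apply/seteqP; split => // w _ /=.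
    by rewrite in_itv/= andbT; case/andP: (U01 w) => + _; exact: lt_trans.
  have [x1|x1] := leP 1 x.
    rewrite /uniform_prob integral_uniform_pdf.
    rewrite [in RHS](_ : _ `&` _ = set0); last first.
      apply/seteqP; split => // y [] /=; rewrite !in_itv/= andbT => xy /andP[_ y1].
      by have := lt_le_trans xy (le_trans y1 x1); rewrite ltxx.
    rewrite integral_set0; transitivity (P set0); last exact: measure0.
    congr (P _); apply/seteqP; split => // w /=.
    rewrite in_itv/= andbT; case/andP: (U01 w) => _ U1 xU.
    by have := lt_trans xU (lt_le_trans U1 x1); rewrite ltxx.
  have -> : uniform_prob (@ltr01 R) `]x, +oo[ = (1 - x)%:E.
    rewrite /uniform_prob integral_uniform_pdf.
    rewrite [in LHS](_ : _ `&` _ = `]x, 1]%classic); last first.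
      apply/seteqP; split => y /=; rewrite !in_itv/= andbT.
        by move=> [-> /andP[_ ->]].
      by move=> /andP[xy y1]; rewrite xy y1 (le_trans x0 (ltW xy)).
    rewrite (eq_integral (fun=> 1%:E)); last first.
      move=> y; rewrite inE/= in_itv/= => /andP[xy y1].
      by rewrite /uniform_pdf y1 (le_trans x0 (ltW xy))/= subr0 invr1.
    by rewrite integral_cst// mul1e /= lebesgue_measure_itv/= lte_fin x1.
  have -> : distribution P U `]x, +oo[ = (1 - cdf U x)%E.
    rewrite /cdf -probability_setC//; congr (distribution P U _).
    by rewrite setCitvl.
  move: x0; rewrite le_eqVlt => /predU1P[<-|x0]; last by rewrite U_cdf ?x0.
  rewrite /cdf (_ : distribution P U `]-oo, 0] = 0%E)//.
  transitivity (P set0); last exact: measure0.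
  congr (P _); apply/seteqP; split => // w /=.
  by rewrite in_itv/= leNgt; case/andP: (U01 w) => ->.
- by move=> k; rewrite (le_lt_trans (probability_le1 _ _))// ltry.
Qed.

Lemma Rintegral_uniform (f : R -> R) : bounded_mfun f ->
  \int[P]_w f (U w) = \int[mu]_(x in `[0, 1]) f x.
Proof.
move=> bf; have [mf [M fM]] := bf.
have mU : measurable_fun setT (U : T -> measurableTypeR R).
  by move=> mT B mB; exact: (@measurable_funPT _ _ _ _ U mT B mB).
pose U' : {mfun T >-> measurableTypeR R} :=
  MeasurableFun.Pack (MeasurableFun.Class
    (isMeasurableFun.Build _ _ T (measurableTypeR R) (U : T -> measurableTypeR R) mU)).
pose Q : probability (measurableTypeR R) R := uniform_prob (@ltr01 R).
have bf' : @bounded_mfun _ (measurableTypeR R) R f by [].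
have bM : @bounded_mfun _ (measurableTypeR R) R (fun=> M) by exact: bounded_mfun_cst.
transitivity (\int[distribution P U']_x f x).
  exact: (Rintegral_distribution P U' bf').
transitivity (\int[Q]_x f x).
  by congr fine; apply: eq_measure_integral => A mA _; exact: uniform_distribution.
(* Adding the bound [M] makes the integrand nonnegative, as [integral_uniform] demands. *)
have -> : \int[Q]_x f x = \int[Q]_x (f x + M) - M.
  by rewrite (bounded_RintegralD _ bf' bM) Rintegral_prob_cst addrK.
have -> : \int[Q]_x (f x + M) = \int[mu]_(x in `[0, 1]) (f x + M).
  rewrite /Rintegral integral_uniform.
  - by rewrite subr0 invr1 mul1e.
  - by apply/measurable_EFinP; exact: measurable_funD.
  - by move=> x; rewrite lee_fin; have := fM x; rewrite ler_norml => /andP[]; lra.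
rewrite RintegralD//; last 2 first.
- exact: bounded_mfun_integrable_itv.
- by apply: (bounded_mfun_integrable_itv _ _ bM).
by rewrite Rintegral_cst//= lebesgue_measure_itv/= lte_fin ltr01 oppr0 adde0 mulr1 addrK.
Qed.

End uniform_law.

(** * Explicit integrals of [x ln x], of the ratio and of its indicator *)

Section elementary_integrals.
Context (R : realType).
Local Notation mu := (@lebesgue_measure R).

Lemma is_derive_derive1 (F : R -> R) (x l : R) : is_derive x 1 F l ->
  derivable F x 1 /\ F^`()%classic x = l.
Proof. by move=> [dF <-]; rewrite derive1E. Qed.

Lemma Rintegral_FTC (a b : R) (F f : R -> R) : a < b ->
  (forall x, x \in `[a, b] -> {for x, continuous f}) ->
  (forall x, x \in `[a, b] -> {for x, continuous F}) ->
  (forall x, x \in `]a, b[ -> derivable F x 1 /\ F^`()%classic x = f x) ->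
  \int[mu]_(x in `[a, b]) f x = F b - F a.
Proof.
move=> ab cf cF dF; rewrite /Rintegral (@continuous_FTC2 _ f F)//.
- by apply: continuous_in_subspaceT => x; rewrite inE => xab; exact: cf.
- split.
  + by move=> x /dF[].
  + by apply: cvg_at_right_filter; apply: cF; rewrite in_itv/= lexx ltW.
  + by apply: cvg_at_left_filter; apply: cF; rewrite in_itv/= lexx ltW.
- by move=> x /dF[].
Qed.

Lemma Rintegral_split (c : R) (f : R -> R) : 0 <= c <= 1 ->
  mu.-integrable `[0, 1] (EFin \o f) ->
  \int[mu]_(x in `[0, 1]) f x =
  \int[mu]_(x in `[0, c]) f x + \int[mu]_(x in `[c, 1]) f x.
Proof.
move=> /andP[c0 c1] intf.
have := @Rintegral_itvB _ f (BLeft 0) (BRight 1) c intf.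
rewrite !bnd_simp => /(_ c0 c1) H.
rewrite -[LHS](subrK (\int[mu]_(x in `[0, c]) f x)) H addrC; congr (_ + _).
rewrite Rintegral_itv_obnd_cbnd//; apply: integrableS intf => //.
by apply: subset_itvr; rewrite bnd_simp.
Qed.

Lemma measurable_invr : measurable_fun setT (@GRing.inv R).
Proof.
have -> : [set: R] = ~` [set 0] `|` [set 0] by rewrite setUC setUv.
have oN0 : open (~` [set (0 : R)]) by exact/closed_openC/closed_eq.
apply/measurable_funU => //; first exact: measurableC.
split; last exact: measurable_fun_set1.
apply: open_continuous_measurable_fun => // x; rewrite inE /= => /eqP x0.
exact: inv_continuous.
Qed.

Definition xlnx (z : R) := z * ln z.

Lemma is_derive_xlnx (z : R) : 0 < z -> is_derive z 1 xlnx (ln z + 1).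
Proof.
move=> z0; have dln := is_derive1_ln z0.
have -> : xlnx = id * (@ln R) by apply/funext.
by apply: is_derive_eq; rewrite /GRing.scale/= mulfV ?gt_eqF// mulr1 addrC.
Qed.

(** The inequality [ln u < u] at [u = 1 / sqrt z]. It yields both continuity at 0 and boundedness on
    the unit interval. *)
Lemma xlnx_bound (z : R) : 0 <= z <= 1 -> - (2 * Num.sqrt z) <= xlnx z <= 0.
Proof.
move=> /andP[z0 z1]; rewrite [X in _ && X]mulr_ge0_le0 ?ln_le0// andbT /xlnx.
move: z0; rewrite le_eqVlt => /predU1P[<-|z0]; first by rewrite mul0r sqrtr0 mulr0 oppr0.
set q := Num.sqrt z; have q0 : 0 < q by rewrite sqrtr_gt0.
have zq : z = q ^+ 2 by rewrite sqr_sqrtr// ltW.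
have := @ln_sublinear R q^-1; rewrite invr_gt0 => /(_ q0).
rewrite lnV ?posrE// zq lnXn// -mulr_natl => H.
have : q * - ln q <= 1 by rewrite -ler_pdivlMl// mulr1 ltW.
nra.
Qed.

(** Left of 0 the function vanishes because [ln] is 0 there by convention; at 0 the square-root
    bound applies. *)
Lemma continuous_xlnx : continuous xlnx.
Proof.
move=> z; have [z0|z0|->] := ltgtP z 0.
- apply: (@cvg_trans _ ((fun=> 0 : R) @ z)).
    apply: near_eq_cvg; near=> y; rewrite /xlnx ln0 ?mulr0//.
    by apply: ltW; near: y; exact: lt_nbhsl.
  have -> : xlnx z = 0 by rewrite /xlnx ln0 ?mulr0// ltW.
  exact: (@cvg_cst R 0 R (nbhs z) _).
- apply/differentiable_continuous/derivable1_diffP.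
  by have [] := is_derive_xlnx z0.
rewrite /continuous_at {2}/xlnx mul0r; apply/cvgrPdist_le => e e0.
near=> y; rewrite sub0r normrN.
have [y0|y0] := leP y 0; first by rewrite /xlnx ln0// mulr0 normr0 ltW.
have y1 : y <= 1.
  by apply: ltW; near: y; apply: lt_nbhsl; exact: ltr01.
have ye : y <= (e / 2) ^+ 2.
  by apply: ltW; near: y; apply: lt_nbhsl; rewrite exprn_gt0// divr_gt0.
have /andP[l u] : - (2 * Num.sqrt y) <= xlnx y <= 0 by apply: xlnx_bound; rewrite y1 ltW.
have sq : Num.sqrt y <= e / 2.
  by have := ler_wsqrtr ye; rewrite sqrtr_sqr ger0_norm// divr_ge0// ltW.
by rewrite ler0_norm//; lra.
Unshelve. all: by end_near. Qed.

Let is_derive_cst_id_mul (c x l : R) (h : R -> R) : is_derive x 1 h l ->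
  is_derive x 1 (cst c * (id * h)) (c * (x * l + h x)).
Proof.
move=> dh; have dih := is_deriveM (is_derive_id x (1 : R)) dh.
apply: is_derive_eq (is_deriveM (is_derive_cst c x (1 : R)) dih) _.
by rewrite /GRing.scale/= mulr0 addr0 mulr1.
Qed.

Lemma Rintegral_id : \int[mu]_(x in `[0, 1]) x = 1 / 2 :> R.
Proof.
transitivity ((cst (1 / 2) * (id * id)) 1 - (cst (1 / 2) * (id * id)) 0 : R).
  apply: Rintegral_FTC; first exact: ltr01.
  - by move=> x _; exact: cvg_id.
  - move=> x _; apply: cvgM; first exact: cvg_cst.
    by apply: cvgM; exact: cvg_id.
  - move=> x _; apply/is_derive_derive1/is_derive_eq; rewrite /GRing.scale/= !fctE/=.
    by field.
by rewrite !fctE/=; field.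
Qed.

Lemma Rintegral_xlnx : \int[mu]_(x in `[0, 1]) xlnx x = - (1 / 4).
Proof.
(* The antiderivative [x^2 ln x / 2 - x^2 / 4], written through [xlnx] so that it is continuous at
   0. *)
pose F : R -> R := cst (1 / 2) * (id * xlnx) - cst (1 / 4) * (id * id).
transitivity (F 1 - F 0); last first.
  by rewrite /F !fctE/= /xlnx ln1; field.
apply: Rintegral_FTC; first exact: ltr01.
- by move=> x _; exact: continuous_xlnx.
- move=> x _; apply: cvgB; (apply: cvgM; first exact: cvg_cst);
    (apply: cvgM; first exact: cvg_id); [exact: continuous_xlnx|exact: cvg_id].
- move=> x; rewrite in_itv/= => /andP[x0 _]; have dx := is_derive_xlnx x0.
  apply/is_derive_derive1/is_derive_eq; rewrite /GRing.scale/= !fctE/= /xlnx.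
  by move: (ln x) => l; field.
Qed.

Lemma Rintegral_xlnx_sqr : \int[mu]_(x in `[0, 1]) (xlnx x ^+ 2) = 2 / 27.
Proof.
(* Two integrations by parts: [x^3 (ln^2 x / 3 - 2 ln x / 9 + 2 / 27)]. *)
pose F : R -> R := cst (1 / 3) * (id * (xlnx * xlnx)) -
  cst (2 / 9) * (id * (id * xlnx)) + cst (2 / 27) * (id * (id * id)).
transitivity (F 1 - F 0); last first.
  by rewrite /F !fctE/= /xlnx ln1; field.
apply: Rintegral_FTC; first exact: ltr01.
- by move=> x _; exact: (cvgM (@continuous_xlnx x) (@continuous_xlnx x)).
- move=> x _; apply: cvgD; first apply: cvgB;
    (apply: cvgM; first exact: cvg_cst); (apply: cvgM; first exact: cvg_id);
    apply: cvgM; (exact: cvg_id || exact: continuous_xlnx).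
- move=> x; rewrite in_itv/= => /andP[x0 _]; have dx := is_derive_xlnx x0.
  have d1 := is_derive_cst_id_mul (1 / 3) (is_deriveM dx dx).
  have d2 := is_derive_cst_id_mul (2 / 9) (is_deriveM (is_derive_id x (1 : R)) dx).
  have dii := is_deriveM (is_derive_id x (1 : R)) (is_derive_id x (1 : R)).
  have d3 := is_derive_cst_id_mul (2 / 27) dii.
  have [dF F'] := is_derive_derive1 (is_deriveD (is_deriveB d1 d2) d3).
  split; first exact: dF.
  rewrite [LHS]F' /GRing.scale/= !fctE/= /xlnx.
  by move: (ln x) => l; field.
Qed.

(* The maximum with 0 is only there to make ratio bounded on all of R^2. *)
Definition ratio (x y : R) := Num.max 0 (Num.min (x / y) (y / x)).

Lemma ratioC x y : ratio x y = ratio y x.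
Proof. by rewrite /ratio minC. Qed.

Lemma ratio_le (x y : R) : 0 <= y -> y <= x -> ratio x y = y / x.
Proof.
move=> y0 yx; have x0 : 0 <= x by exact: le_trans yx.
rewrite /ratio; have [->|yn0] := eqVneq y 0; first by rewrite invr0 mulr0 mul0r minxx maxxx.
have {y0}y0 : 0 < y by rewrite lt_neqAle eq_sym yn0.
have {x0}x0 : 0 < x by exact: lt_le_trans yx.
rewrite min_r; first by rewrite max_r// divr_ge0// ltW.
by rewrite ler_pdivrMr// mulrAC ler_pdivlMr// -!expr2 ler_pXn2r// nnegrE ltW.
Qed.

Lemma ratio01 x y : 0 <= ratio x y <= 1.
Proof.
rewrite /ratio le_max lexx/= ge_max ler01/= ge_min.
have [->|y0] := eqVneq y 0; first by rewrite invr0 mulr0 ler01.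
have [->|x0] := eqVneq x 0; first by rewrite mul0r ler01.
have [//|H /=] := leP (x / y) 1.
rewrite -[y / x]invrK invf_div invf_le1 ?ltW//; exact: lt_trans H.
Qed.

Lemma measurable_ratio : measurable_fun setT (fun p : R * R => ratio p.1 p.2).
Proof.
apply: measurable_maxr => //; apply: measurable_minr; apply: measurable_funM => //;
  by apply: (measurableT_comp measurable_invr).
Qed.

Lemma bounded_ratio x : bounded_mfun (ratio x).
Proof.
split; last by exists 1 => y; have := ratio01 x y; rewrite ler_norml; lra.
have mx : measurable_fun setT (fun y : R => (x, y)).
  by apply: measurable_fun_pair => //; exact: measurable_cst.
exact: (measurableT_comp measurable_ratio mx).
Qed.

(** Below [x] the integrand is [y / x] and contributes [x / 2], above it is [x / y] and contributes
    [- x ln x]. This is where [x ln x] enters [proj_pair]. *)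
Lemma Rintegral_ratio x : 0 < x < 1 ->
  \int[mu]_(y in `[0, 1]) ratio x y = x / 2 - xlnx x.
Proof.
move=> /andP[x0 x1].
rewrite (@Rintegral_split x) ?(ltW x0) ?(ltW x1)//; last first.
  by apply: bounded_mfun_integrable_itv; exact: bounded_ratio.
have -> : \int[mu]_(y in `[0, x]) ratio x y = \int[mu]_(y in `[0, x]) (y / x).
  apply: eq_Rintegral.
  by move=> y; rewrite inE/= in_itv/= => /andP[y0 yx]; rewrite ratio_le.
have -> : \int[mu]_(y in `[x, 1]) ratio x y = \int[mu]_(y in `[x, 1]) (x / y).
  apply: eq_Rintegral.
  move=> y; rewrite inE/= in_itv/= => /andP[xy _].
  by rewrite ratioC ratio_le// ltW.
rewrite (@Rintegral_FTC 0 x (cst (1 / 2 / x) * (id * id)))//; last 3 first.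
- by move=> y _; apply: cvgM; [exact: cvg_id|exact: cvg_cst].
- by move=> y _; apply: cvgM; [exact: cvg_cst|apply: cvgM; exact: cvg_id].
- move=> y _; apply/is_derive_derive1/is_derive_eq; rewrite /GRing.scale/= !fctE/=.
  by field; rewrite gt_eqF.
rewrite (@Rintegral_FTC x 1 (cst x * @ln R))//; last 3 first.
- move=> y; rewrite in_itv/= => /andP[xy _]; apply: cvgM; first exact: cvg_cst.
  by apply: inv_continuous; rewrite gt_eqF// (lt_le_trans x0).
- move=> y; rewrite in_itv/= => /andP[xy _]; apply: cvgM; first exact: cvg_cst.
  by apply: continuous_ln; rewrite (lt_le_trans x0).
- move=> y; rewrite in_itv/= => /andP[xy _].
  have dln := is_derive1_ln (lt_trans x0 xy).
  by apply/is_derive_derive1/is_derive_eq; rewrite /GRing.scale/= mulr0 addr0.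
by rewrite !fctE/= ln1 /xlnx; field; rewrite gt_eqF.
Qed.

(** Serves twice: as [min(1, y / z)] in the law of the ratio, and to extend functions on the unit
    interval to bounded functions on the line. *)
Definition clamp (u : R) := Num.max 0 (Num.min 1 u).

Lemma bounded_clamp_div (z : R) : bounded_mfun (fun y : R => clamp (y / z)).
Proof.
split.
  apply: measurable_maxr => //; apply: measurable_minr => //.
  by apply: measurable_funM => //; exact: measurable_cst.
exists 1 => y; rewrite ger0_norm /clamp ?le_max ?lexx//.
by rewrite ge_max ler01 ge_min lexx.
Qed.

Lemma clamp_ge0 (u : R) : 0 <= u -> clamp u = Num.min 1 u.
Proof. by move=> u0; rewrite /clamp max_r// le_min ler01. Qed.

Lemma Rintegral_clamp_div z : 0 < z < 1 ->
  \int[mu]_(y in `[0, 1]) clamp (y / z) = 1 - z / 2.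
Proof.
move=> /andP[z0 z1].
rewrite (@Rintegral_split z) ?(ltW z0) ?(ltW z1)//; last first.
  by apply: bounded_mfun_integrable_itv; exact: bounded_clamp_div.
have -> : \int[mu]_(y in `[0, z]) clamp (y / z) = \int[mu]_(y in `[0, z]) (y / z).
  apply: eq_Rintegral.
  move=> y; rewrite inE/= in_itv/= => /andP[y0 yz].
  by rewrite clamp_ge0 ?divr_ge0 ?(ltW z0)// min_r// ler_pdivrMr// mul1r.
have -> : \int[mu]_(y in `[z, 1]) clamp (y / z) = \int[mu]_(y in `[z, 1]) 1.
  apply: eq_Rintegral.
  move=> y; rewrite inE/= in_itv/= => /andP[yz _].
  have y0 : 0 <= y by exact: le_trans (ltW z0) yz.
  by rewrite clamp_ge0 ?divr_ge0 ?(ltW z0)// min_l// ler_pdivlMr// mul1r.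
rewrite (@Rintegral_FTC 0 z (cst (1 / 2 / z) * (id * id)))//; last 3 first.
- by move=> y _; apply: cvgM; [exact: cvg_id|exact: cvg_cst].
- by move=> y _; apply: cvgM; [exact: cvg_cst|apply: cvgM; exact: cvg_id].
- move=> y _; apply/is_derive_derive1/is_derive_eq; rewrite /GRing.scale/= !fctE/=.
  by field; rewrite gt_eqF.
rewrite (@Rintegral_FTC z 1 id)//; last 3 first.
- by move=> y _; exact: cvg_cst.
- by move=> y _; exact: cvg_id.
- by move=> y _; apply/is_derive_derive1.
by rewrite !fctE/=; field; rewrite gt_eqF.
Qed.

Lemma Rintegral_indic_itv01 (A : set R) : measurable A -> A `<=` `[0, 1] ->
  \int[mu]_(x in `[0, 1]) (\1_A x : R) = fine (mu A).
Proof. by move=> mA A01; rewrite /Rintegral integral_indic// setIidl. Qed.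

Lemma bounded_mfun_ltr (c : R) : bounded_mfun (fun z : R => (c < z)%R%:R : R).
Proof.
split; last by exists 1 => z; case: (c < z); rewrite ?normr1 ?normr0.
have -> : (fun z : R => (c < z)%R%:R : R) = \1_`]c, +oo[.
  apply/funext => z; rewrite indicE; congr (nat_of_bool _)%:R.
  by apply/idP/idP; rewrite ?inE/= in_itv/= andbT.
exact: measurable_indic.
Qed.

Lemma Rintegral_ltr c : 0 <= c <= 1 ->
  \int[mu]_(z in `[0, 1]) (c < z)%R%:R = 1 - c.
Proof.
move=> /andP[c0 c1].
have -> : \int[mu]_(z in `[0, 1]) (c < z)%R%:R = \int[mu]_(z in `[0, 1]) (\1_`]c, 1] z : R).
  apply: eq_Rintegral.
  move=> z; rewrite inE/= in_itv/= => /andP[z0 z1]; rewrite indicE; congr (nat_of_bool _)%:R.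
  by apply/idP/idP; rewrite ?inE/= in_itv/= z1 andbT.
rewrite Rintegral_indic_itv01//; last first.
  by move=> z /=; rewrite !in_itv/= => /andP[cz ->]; rewrite (le_trans c0 (ltW cz)).
rewrite lebesgue_measure_itv/= lte_fin; case: ltP => //= c1'.
by apply/eqP; rewrite eq_sym subr_eq0 eq_le c1 c1'.
Qed.

(** For fixed [y] and [z] the complementary event is an interval in [x], so its probability is a
    length. *)
Lemma ratio_ltE (x y z : R) : 0 <= x <= 1 -> 0 < y < 1 -> 0 < z < 1 ->
  (ratio x y < z) = ~~ (y * z <= x <= y / z).
Proof.
move=> /andP[x0 x1] /andP[y0 y1] /andP[z0 z1]; rewrite ltNge; congr negb.
have [yx|xy] := leP y x.
  have x0' : 0 < x by exact: lt_le_trans yx.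
  rewrite ratio_le ?(ltW y0)// !ler_pdivlMr// mulrC.
  have -> : y * z <= x by rewrite (le_trans _ yx)// ler_piMr// ltW.
  by [].
rewrite ratioC ratio_le ?(ltW xy)// !ler_pdivlMr//.
rewrite mulrC; have -> : x * z <= y by rewrite (le_trans _ (ltW xy))// ler_piMr// ltW.
by rewrite andbT.
Qed.

(** One minus the length of the interval of [ratio_ltE], whose right end is cut at 1 by [clamp]. *)
Lemma Rintegral_ratio_ltr (y z : R) : 0 < y < 1 -> 0 < z < 1 ->
  \int[mu]_(x in `[0, 1]) (ratio x y < z)%R%:R = 1 - clamp (y / z) + y * z.
Proof.
move=> y01 z01; have /andP[y0 y1] := y01; have /andP[z0 z1] := z01.
have cE : clamp (y / z) = Num.min 1 (y / z) by rewrite clamp_ge0// divr_ge0// ltW.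
have yzc : y * z <= clamp (y / z).
  rewrite cE le_min; apply/andP; split; first by rewrite mulr_ile1// ltW.
  rewrite (@le_trans _ _ y)//; first by rewrite ler_piMr// ltW.
  by rewrite ler_pdivlMr// ler_piMr// ltW.
have -> : \int[mu]_(x in `[0, 1]) (ratio x y < z)%R%:R =
    \int[mu]_(x in `[0, 1]) (1 - \1_`[y * z, clamp (y / z)] x).
  apply: eq_Rintegral.
  move=> x; rewrite inE/= in_itv/= => x01; rewrite ratio_ltE// indicE.
  have -> : (x \in `[y * z, clamp (y / z)]%classic) = (y * z <= x <= y / z).
    rewrite cE; case/andP: x01 => _ x1.
    by apply/idP/idP; rewrite ?inE/= in_itv/= le_min x1.
  by case: (_ <= _ <= _) => /=; rewrite ?subrr ?subr0.
rewrite RintegralB//; last 2 first.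
- by apply: bounded_mfun_integrable_itv; exact: bounded_mfun_cst.
- by apply: bounded_mfun_integrable_itv; exact: bounded_mfun_indic.
rewrite Rintegral_cst// Rintegral_indic_itv01//; last first.
  move=> x /=; rewrite !in_itv/= cE le_min => /andP[yzx /andP[-> _]]; rewrite andbT.
  by rewrite (le_trans _ yzx)// mulr_ge0// ltW.
have -> : fine (mu `[0, 1]) = 1 by rewrite /= lebesgue_measure_itv/= lte_fin ltr01 oppr0 adde0.
rewrite lebesgue_measure_itv/= lte_fin mulr1.
case: ltP => /= c; first by rewrite opprB addrCA addrC.
by rewrite subr0 -addrA [- _ + _](_ : _ = 0) ?addr0//; apply/eqP; rewrite addrC subr_eq0 eq_le yzc.
Qed.

End elementary_integrals.

(** * The degenerate kernel *)

Section two_free_indices.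
Context d (T : measurableType d) (R : realType) (P : probability T R).
Variable X : nat -> {RV P >-> R}.

Lemma sigma_cylinder_mono (J J' : {fset nat}) : (J `<=` J')%fset ->
  <<s cylinder X J >> `<=` <<s cylinder X J' >>.
Proof.
move=> JJ'; apply: sub_smallest2r; first exact: smallest_sigma_algebra.
move=> _ [B mB ->]; exists (fun i => if i \in J then B i else setT).
  by move=> i; case: ifP.
apply/seteqP; split => w Bw i /= iJ.
  by case: ifPn => // iJ0; exact: Bw.
by have := Bw i (fsubsetP JJ' _ iJ); rewrite /= iJ.
Qed.

Lemma bounded_mfun_sigma_cylinder_mono (J J' : {fset nat}) (Z : T -> R) :
  (J `<=` J')%fset -> bounded_mfun (Z : sigma_cylinder X J -> R) ->
  bounded_mfun (Z : sigma_cylinder X J' -> R).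
Proof.
move=> JJ' [mZ [M ZM]]; split; last by exists M.
by move=> _ B mB; apply: (sigma_cylinder_mono JJ'); exact: mZ.
Qed.

Hypothesis X_indep : mutually_independent X.

(* Integrate out X c first, then X b; the other factor Z only sees the indices in J. *)
Lemma indep_two_steps (K : (R * (R * R))%type -> R) (J : {fset nat}) (a b c : nat)
    (Z : sigma_cylinder X J -> R) :
  bounded_mfun K -> a \in J -> b \notin J -> c \notin J -> b != c ->
  bounded_mfun Z ->
  (forall w, \int[P]_v \int[P]_u K (X c u, (X b v, X a w)) = 0) ->
  \int[P]_w (K (X c w, (X b w, X a w)) * Z w) = 0.
Proof.
move=> bK aJ bJ cJ bc bZ K0.
pose J' := (b |` J)%fset.
have JJ' : (J `<=` J')%fset by exact: fsubsetU1.
have cJ' : c \notin J' by rewrite in_fset1U negb_or eq_sym bc.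
pose q (p : R * R) := \int[distribution P (X c)]_x K (x, p).
have bq : bounded_mfun q.
  (* The product law only supplies some probability on [R * R]; measurability of [q] is all that is
     extracted. *)
  exact: (bounded_mfun_Rintegral_section (distribution P (X c))
    (distribution P (X c) \x distribution P (X c))%E bK).
pose f1 (z : (R * sigma_cylinder X J')%type) :=
  K (z.1, (X b z.2, X a z.2)) * Z z.2.
have bf1 : bounded_mfun f1.
  apply: bounded_mfunM.
    apply: (bounded_mfun_comp _ bK); apply: measurable_fun_pair => //.
    apply: measurable_fun_pair.
      apply: (measurableT_comp (@measurable_sigma_cylinder _ _ _ _ X J' b _)) => //.
      by rewrite fset1U1.
    apply: (measurableT_comp (@measurable_sigma_cylinder _ _ _ _ X J' a _)) => //.
    by rewrite fset1Ur.
  by apply: (bounded_mfun_comp _ (bounded_mfun_sigma_cylinder_mono JJ' bZ)).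
have -> := indep_Rintegral X_indep cJ' bf1.
pose f2 (z : (R * sigma_cylinder X J)%type) := q (z.1, X a z.2) * Z z.2.
have bf2 : bounded_mfun f2.
  apply: bounded_mfunM; last by apply: (bounded_mfun_comp _ bZ).
  apply: (bounded_mfun_comp _ bq); apply: measurable_fun_pair => //.
  exact: (measurableT_comp (@measurable_sigma_cylinder _ _ _ _ X J a aJ)).
transitivity (\int[P]_w f2 (X b w, w)).
  apply: eq_Rintegral => w _; rewrite /f1 /f2 /q /= RintegralZr//.
  by apply: bounded_mfun_integrable; exact: bounded_mfun_section.
rewrite (indep_Rintegral X_indep bJ bf2) -[RHS](Rintegral_prob_cst P).
apply: eq_Rintegral => w _; rewrite /f2/=.
have bqa : bounded_mfun (fun x => q (x, X a w)) by exact: bounded_mfun_section.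
rewrite RintegralZr//; last by apply: bounded_mfun_integrable.
rewrite (_ : \int[_]_x _ = 0) ?mul0r// -(Rintegral_distribution P (X b) bqa) -[RHS](K0 w).
apply: eq_Rintegral => v _; rewrite /q.
by rewrite (Rintegral_distribution P (X c) (bounded_mfun_section bK _)).
Qed.

End two_free_indices.

Section kernel.
Context (R : realType).

Lemma clamp_id (u : R) : 0 <= u <= 1 -> clamp u = u.
Proof. by move=> /andP[u0 u1]; rewrite clamp_ge0// min_r. Qed.

Lemma clamp01 (u : R) : 0 <= clamp u <= 1.
Proof. by rewrite /clamp le_max lexx/= ge_max ler01/= ge_min lexx. Qed.

(* Hoeffding projections of the kernel 1{min(x/y, y/x) < z}, for uniform
   arguments: proj_pair for each of the first two, proj_threshold for the third. *)
Definition proj_pair (x : R) := 1 / 2 - clamp x / 2 + xlnx (clamp x).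
Definition proj_threshold (z : R) := clamp z - 1 / 2.
(** The factor 2: an observation can fill either slot of the pair. *)
Definition score (x : R) := 2 * proj_pair x + proj_threshold x.
Definition degenerate_kernel (x y z : R) : R :=
  (ratio x y < z)%R%:R - 1 / 2 - proj_pair x - proj_pair y - proj_threshold z.

Lemma bounded_mfun_clamp : bounded_mfun (@clamp R).
Proof.
by have := bounded_clamp_div (1 : R); under eq_fun do rewrite divr1.
Qed.

Lemma bounded_mfun_xlnx_clamp : bounded_mfun (fun x : R => xlnx (clamp x)).
Proof.
have [mc _] := bounded_mfun_clamp; split.
  by apply: measurableT_comp mc; apply: continuous_measurable_fun; exact: continuous_xlnx.
exists 2 => x; have /andP[c0 c1] := clamp01 x.
have /andP[l u] := xlnx_bound (clamp01 x).
have : Num.sqrt (clamp x) <= 1 by rewrite -sqrtr1 ler_wsqrtr.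
by rewrite ler_norml; lra.
Qed.

Lemma bounded_mfun_proj_pair : bounded_mfun proj_pair.
Proof.
apply: bounded_mfunD; last exact: bounded_mfun_xlnx_clamp.
apply: bounded_mfunB; first exact: bounded_mfun_cst.
by apply: bounded_mfunM; [exact: bounded_mfun_clamp|exact: bounded_mfun_cst].
Qed.

Lemma bounded_mfun_proj_threshold : bounded_mfun proj_threshold.
Proof.
by apply: bounded_mfunB; [exact: bounded_mfun_clamp|exact: bounded_mfun_cst].
Qed.

Lemma bounded_mfun_score : bounded_mfun score.
Proof.
apply: bounded_mfunD; last exact: bounded_mfun_proj_threshold.
by apply: bounded_mfunZ; exact: bounded_mfun_proj_pair.
Qed.

Lemma bounded_mfun_kernel d (S : measurableType d) (f g h : S -> R) :
  measurable_fun setT f -> measurable_fun setT g -> measurable_fun setT h ->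
  bounded_mfun (fun x => degenerate_kernel (f x) (g x) (h x)).
Proof.
move=> mf mg mh.
have bpf : bounded_mfun (fun x => proj_pair (f x)) := bounded_mfun_comp mf bounded_mfun_proj_pair.
have bpg : bounded_mfun (fun x => proj_pair (g x)) := bounded_mfun_comp mg bounded_mfun_proj_pair.
have bph : bounded_mfun (fun x => proj_threshold (h x)) :=
  bounded_mfun_comp mh bounded_mfun_proj_threshold.
apply: bounded_mfunB => //; apply: bounded_mfunB => //; apply: bounded_mfunB => //.
apply: bounded_mfunB; last exact: bounded_mfun_cst.
split; last by exists 1 => x; case: (_ < _); rewrite ?normr1 ?normr0.
have mr : measurable_fun setT (fun x => ratio (f x) (g x)).
  exact: (measurableT_comp (@measurable_ratio R) (measurable_fun_pair mf mg)).
have -> : (fun x => (ratio (f x) (g x) < h x)%R%:R : R) =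
    (fun x => if ratio (f x) (g x) < h x then 1 else 0).
  by apply/funext => x; case: ifP.
by apply: measurable_fun_ifT => //; exact: measurable_fun_ltr.
Qed.

End kernel.

Section kernel_orthogonality.
Context d (T : measurableType d) (R : realType) (P : probability T R).
Variable X : nat -> {RV P >-> R}.
Hypothesis X_indep : mutually_independent X.
Hypothesis X01 : forall i w, 0 < X i w < 1.
Hypothesis X_cdf : forall i (x : R), 0 < x < 1 -> cdf (X i) x = x%:E.
Local Notation mu := (@lebesgue_measure R).

Let unif i (f : R -> R) : bounded_mfun f ->
  \int[P]_w f (X i w) = \int[mu]_(x in `[0, 1]) f x.
Proof. by move=> bf; apply: Rintegral_uniform => //; exact: X_cdf. Qed.

Let X01' i w : 0 <= X i w <= 1.
Proof. by have /andP[a b] := X01 i w; rewrite !ltW. Qed.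

Let bX (f : R -> R) i : bounded_mfun f -> bounded_mfun (fun w => f (X i w)).
Proof. by move=> bf; apply: (bounded_mfun_comp _ bf); exact: measurable_funPT. Qed.

Let intBc (f : T -> R) (c : R) : bounded_mfun f ->
  \int[P]_w (f w - c) = \int[P]_w f w - c.
Proof.
move=> bf; rewrite bounded_RintegralB//; last exact: bounded_mfun_cst.
by rewrite Rintegral_prob_cst.
Qed.

Lemma mean_clamp i : \int[P]_w clamp (X i w) = 1 / 2.
Proof.
rewrite unif; last exact: bounded_mfun_clamp.
rewrite -Rintegral_id; apply: eq_Rintegral => x; rewrite inE/= in_itv/=.
exact: clamp_id.
Qed.

Lemma mean_xlnx_clamp i : \int[P]_w xlnx (clamp (X i w)) = - (1 / 4).
Proof.
rewrite (unif i (bounded_mfun_xlnx_clamp R)) -Rintegral_xlnx.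
by apply: eq_Rintegral => x; rewrite inE/= in_itv/= => /clamp_id ->.
Qed.

Lemma mean_xlnx_clamp_sqr i : \int[P]_w (xlnx (clamp (X i w)) ^+ 2) = 2 / 27.
Proof.
have b2 : bounded_mfun (fun x : R => xlnx (clamp x) ^+ 2).
  by under eq_fun do rewrite expr2; apply: bounded_mfunM; exact: bounded_mfun_xlnx_clamp.
rewrite (unif i b2) -Rintegral_xlnx_sqr.
by apply: eq_Rintegral => x; rewrite inE/= in_itv/= => /clamp_id ->.
Qed.

Lemma mean_proj_pair i : \int[P]_w proj_pair (X i w) = 0.
Proof.
have bc := bX i (bounded_mfun_clamp R).
have bx := bX i (bounded_mfun_xlnx_clamp R).
have bk := bounded_mfun_cst T (2^-1 : R).
rewrite /proj_pair bounded_RintegralD//; last first.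
  by apply: bounded_mfunB; [exact: bounded_mfun_cst|exact: bounded_mfunM].
rewrite bounded_RintegralB; [|exact: bounded_mfun_cst|exact: bounded_mfunM].
rewrite Rintegral_prob_cst mean_xlnx_clamp RintegralZr ?mean_clamp//; first lra.
exact: bounded_mfun_integrable.
Qed.

Lemma mean_proj_threshold i : \int[P]_w proj_threshold (X i w) = 0.
Proof.
have bc := bX i (bounded_mfun_clamp R).
rewrite /proj_threshold bounded_RintegralB//; last exact: bounded_mfun_cst.
by rewrite Rintegral_prob_cst mean_clamp subrr.
Qed.

Lemma mean_score i : \int[P]_w score (X i w) = 0.
Proof.
have b1 := bX i (bounded_mfun_proj_pair R).
have b2 := bX i (bounded_mfun_proj_threshold R).
rewrite /score bounded_RintegralD//; last exact: bounded_mfunZ.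
by rewrite bounded_RintegralZ// mean_proj_pair mean_proj_threshold mulr0 addr0.
Qed.

Lemma variance_score i : \int[P]_w (score (X i w) ^+ 2) = 5 / 108.
Proof.
have bx := bX i (bounded_mfun_xlnx_clamp R).
have bx2 : bounded_mfun (fun w => xlnx (clamp (X i w)) ^+ 2).
  by under eq_fun do rewrite expr2; exact: bounded_mfunM.
(* The terms linear in [clamp] cancel in the score. The value is
   [1/4 - 2/4 + 4 * (2/27) = 5/108]. *)
transitivity (\int[P]_w
    (2 * xlnx (clamp (X i w)) + 4 * xlnx (clamp (X i w)) ^+ 2 - - (1 / 4))).
  by apply: eq_Rintegral => w _; rewrite /score /proj_pair /proj_threshold; field.
rewrite intBc; last by apply: bounded_mfunD; exact: bounded_mfunZ.
rewrite bounded_RintegralD; [|exact: bounded_mfunZ..].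
rewrite !bounded_RintegralZ// mean_xlnx_clamp mean_xlnx_clamp_sqr.
by field.
Qed.

Lemma kernel_mean_threshold k (x y : R) : 0 < x < 1 -> 0 < y < 1 ->
  \int[P]_w degenerate_kernel x y (X k w) =
  1 / 2 - ratio x y - proj_pair x - proj_pair y.
Proof.
move=> x01 y01; rewrite /degenerate_kernel.
have b0 := bX k (bounded_mfun_ltr (ratio x y)).
have b1 := bX k (bounded_mfun_proj_threshold R).
transitivity (\int[P]_w ((ratio x y < X k w)%R%:R - proj_threshold (X k w) -
    (1 / 2 + proj_pair x + proj_pair y))).
  by apply: eq_Rintegral => w _; ring.
rewrite intBc; last exact: bounded_mfunB.
rewrite bounded_RintegralB// (unif k (bounded_mfun_ltr _)) Rintegral_ltr ?ratio01//.
rewrite mean_proj_threshold; lra.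
Qed.

Lemma kernel_mean_pair i (y z : R) : 0 < y < 1 -> 0 < z < 1 ->
  \int[P]_w degenerate_kernel (X i w) y z =
  1 / 2 - clamp (y / z) + y * z - proj_pair y - proj_threshold z.
Proof.
move=> y01 z01; rewrite /degenerate_kernel.
have bf : bounded_mfun (fun x : R => (ratio x y < z)%R%:R : R).
  split; last by exists 1 => x; case: (_ < _); rewrite ?normr1 ?normr0.
  have mr : measurable_fun setT (fun x : R => ratio x y).
    by under eq_fun do rewrite ratioC; have [] := bounded_ratio y.
  have -> : (fun x => (ratio x y < z)%R%:R : R) = (fun x => if ratio x y < z then 1 else 0).
    by apply/funext => x; case: ifP.
  by apply: measurable_fun_ifT => //; exact: measurable_fun_ltr.
have b0 := bX i bf.
have b1 := bX i (bounded_mfun_proj_pair R).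
transitivity (\int[P]_w ((ratio (X i w) y < z)%R%:R - proj_pair (X i w) -
    (1 / 2 + proj_pair y + proj_threshold z))).
  by apply: eq_Rintegral => w _; ring.
rewrite intBc; last exact: bounded_mfunB.
rewrite bounded_RintegralB// (unif i bf) Rintegral_ratio_ltr// mean_proj_pair; lra.
Qed.

(** Degeneracy given the first argument. Evaluation at separate sample points makes the three
    arguments independent whatever the indices are. *)
Lemma kernel_mean_fst i j k (w : T) :
  \int[P]_v \int[P]_u degenerate_kernel (X i w) (X j v) (X k u) = 0.
Proof.
have x01 := X01 i w; have x01' := X01' i w; move: (X i w) x01 x01' => x x01 x01'.
have -> : \int[P]_v \int[P]_u degenerate_kernel x (X j v) (X k u) =
    \int[P]_v (1 / 2 - ratio x (X j v) - proj_pair x - proj_pair (X j v)).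
  by apply: eq_Rintegral => v _; exact: kernel_mean_threshold.
have b0 := bX j (bounded_ratio x).
have b1 := bX j (bounded_mfun_proj_pair R).
transitivity (- \int[P]_v (ratio x (X j v) + proj_pair (X j v) - (1 / 2 - proj_pair x))).
  rewrite -[RHS]mulN1r -bounded_RintegralZ; last first.
    by apply: bounded_mfunB; [exact: bounded_mfunD|exact: bounded_mfun_cst].
  by apply: eq_Rintegral => v _; ring.
rewrite intBc; last exact: bounded_mfunD.
rewrite bounded_RintegralD// (unif j (bounded_ratio _)) Rintegral_ratio// mean_proj_pair.
rewrite /proj_pair clamp_id//; lra.
Qed.

(** The ratio of two independent uniform variables is uniform: [1 - (1 - z / 2) + z / 2 = z], which
    is what [1 / 2 + proj_threshold z] subtracts. *)
Lemma kernel_mean_thd i j k (w : T) :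
  \int[P]_v \int[P]_u degenerate_kernel (X i u) (X j v) (X k w) = 0.
Proof.
have z01 := X01 k w; have z01' := X01' k w; move: (X k w) z01 z01' => z z01 z01'.
(* [X j v] is replaced by its own clamp so that the integrand is bounded on the whole line. *)
have -> : \int[P]_v \int[P]_u degenerate_kernel (X i u) (X j v) z =
    \int[P]_v (1 / 2 - clamp (X j v / z) + clamp (X j v) * z -
      proj_pair (X j v) - proj_threshold z).
  by apply: eq_Rintegral => v _; rewrite kernel_mean_pair// (clamp_id (X01' j v)).
have b0 := bX j (bounded_clamp_div z).
have b1 := bX j (bounded_mfun_proj_pair R).
have b2 := bounded_mfunZ z (bX j (bounded_mfun_clamp R)).
transitivity (\int[P]_v (z * clamp (X j v) - clamp (X j v / z) - proj_pair (X j v) -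
    (proj_threshold z - 1 / 2))).
  by apply: eq_Rintegral => v _; ring.
rewrite intBc; last by apply: bounded_mfunB => //; exact: bounded_mfunB.
rewrite bounded_RintegralB//; last exact: bounded_mfunB.
rewrite bounded_RintegralB// bounded_RintegralZ; last exact: bX (bounded_mfun_clamp R).
rewrite (unif j (bounded_clamp_div z)) Rintegral_clamp_div// mean_proj_pair mean_clamp.
rewrite /proj_threshold clamp_id//; lra.
Qed.

Lemma degenerate_kernelC (x y z : R) : degenerate_kernel x y z = degenerate_kernel y x z.
Proof. by rewrite /degenerate_kernel ratioC; ring. Qed.

Local Notation ker i j k := (fun w => degenerate_kernel (X i w) (X j w) (X k w)).

(** The three cases name the index that stays frozen. It may recur in [s]; the other two occur only
    once. *)
Definition two_free (i j k : nat) (s : seq nat) :=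
  [|| [&& j \notin i :: s, k \notin i :: s & j != k],
      [&& i \notin j :: s, k \notin j :: s & i != k] |
      [&& i \notin k :: s, j \notin k :: s & i != j]].

Let bker i j k (J : {fset nat}) : i \in J -> j \in J -> k \in J ->
  bounded_mfun (ker i j k : sigma_cylinder X J -> R).
Proof. by move=> iJ jJ kJ; apply: bounded_mfun_kernel; exact: measurable_sigma_cylinder. Qed.

Let mK (f g h : R * (R * R) -> R) : measurable_fun setT f -> measurable_fun setT g ->
  measurable_fun setT h -> bounded_mfun (fun p => degenerate_kernel (f p) (g p) (h p)).
Proof. exact: bounded_mfun_kernel. Qed.

Let m1 : measurable_fun setT (fun p : R * (R * R) => p.1).
Proof. exact: measurable_fst. Qed.
Let m2 : measurable_fun setT (fun p : R * (R * R) => p.2.1).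
Proof. exact: (measurableT_comp measurable_fst measurable_snd). Qed.
Let m3 : measurable_fun setT (fun p : R * (R * R) => p.2.2).
Proof. exact: (measurableT_comp measurable_snd measurable_snd). Qed.

Lemma kernel_orthogonal i j k i' j' k' : two_free i j k [:: i'; j'; k'] ->
  \int[P]_w (ker i j k w * ker i' j' k' w) = 0.
Proof.
have bZ a : bounded_mfun (ker i' j' k' : sigma_cylinder X [fset a; i'; j'; k']%fset -> R).
  by apply: bker; rewrite !inE eqxx ?orbT.
have inJ a b : (b \notin [:: a; i'; j'; k']) = (b \notin [fset a; i'; j'; k']%fset).
  by rewrite !inE !orbA.
have aJ a : a \in [fset a; i'; j'; k']%fset by rewrite !inE eqxx.
rewrite /two_free !inJ => /or3P[] /and3P[nb nc bc].
- apply: (@indep_two_steps _ _ _ _ _ X_indep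
    (fun p => degenerate_kernel p.2.2 p.2.1 p.1) _ i j k _ _ (aJ i) nb nc bc (bZ i)).
    exact: mK.
  by move=> w; exact: kernel_mean_fst.
- apply: (@indep_two_steps _ _ _ _ _ X_indep
    (fun p => degenerate_kernel p.2.1 p.2.2 p.1) _ j i k _ _ (aJ j) nb nc bc (bZ j)).
    exact: mK.
  move=> w; rewrite -[RHS](kernel_mean_fst j i k w); apply: eq_Rintegral => v _.
  by apply: eq_Rintegral => u _; rewrite degenerate_kernelC.
- apply: (@indep_two_steps _ _ _ _ _ X_indep
    (fun p => degenerate_kernel p.2.1 p.1 p.2.2) _ k i j _ _ (aJ k) nb nc bc (bZ k)).
    exact: mK.
  move=> w; rewrite -[RHS](kernel_mean_thd j i k w); apply: eq_Rintegral => v _.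
  by apply: eq_Rintegral => u _; rewrite degenerate_kernelC.
Qed.

End kernel_orthogonality.

(** Five distinct values leave room for one coincidence. Across the triples it spares two indices in
    each; inside one triple it leaves the other triple entirely free. *)
Lemma two_freeP (i j k i' j' k' : nat) : i != j -> i' != j' ->
  (4 < size (undup [:: i; j; k; i'; j'; k']))%N ->
  two_free i j k [:: i'; j'; k'] || two_free i' j' k' [:: i; j; k].
Proof.
have E x s : size (undup (x :: s)) = ((x \notin s) + size (undup s))%N.
  by move=> /=; case: ifP.
rewrite !E /two_free /= !inE.
repeat match goal with |- context [?a == ?b] =>
  case: (a =P b) => [?|?]; [try subst; rewrite ?eqxx|]; rewrite //=; try congruence end.
Qed.

(** * Counting the index sextuples that contribute *)

Section counting.
Variable n : nat.

Definition triple := ('I_n * 'I_n * 'I_n)%type.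

Definition six (p : triple * triple) : seq 'I_n :=
  [:: p.1.1.1; p.1.1.2; p.1.2; p.2.1.1; p.2.1.2; p.2.2].

Definition few_values : {set triple * triple} :=
  [set p : triple * triple | (size (undup (six p)) <= 4)%N]%SET.

(* A sextuple with at most four values factors through a 4-tuple of values. *)
Lemma card_few_values : (#|few_values| <= 4 ^ 6 * n ^ 4)%N.
Proof.
pose code := ('I_4 * 'I_4 * 'I_4)%type.
pose f (c : 4.-tuple 'I_n * (code * code)) : triple * triple :=
  let g := tnth c.1 in
  ((g c.2.1.1.1, g c.2.1.1.2, g c.2.1.2), (g c.2.2.1.1, g c.2.2.1.2, g c.2.2.2)).
have sub : few_values \subset (f @: [set: 4.-tuple 'I_n * (code * code)])%SET.
  apply/fintype.subsetP => -[[[i j] k] [[i' j'] k']]; rewrite inE => s4.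
  set s := undup _ in s4.
  (* The default [i] pads the tuple when there are fewer than four values. *)
  pose b := [tuple nth i s l | l < 4].
  have bK x : x \in s -> tnth b (inord (index x s)) = x.
    move=> xs; rewrite tnth_mktuple inordK ?nth_index//.
    by rewrite (leq_trans _ s4)// index_mem.
  have ms x : x \in six ((i, j, k), (i', j', k')) -> x \in s by rewrite mem_undup.
  pose c x : 'I_4 := inord (index x s).
  apply/imsetP; exists (b, ((c i, c j, c k), (c i', c j', c k'))); first by rewrite inE.
  by rewrite /f /= !bK// ms// !inE eqxx ?orbT.
rewrite (leq_trans (subset_leq_card sub))// (leq_trans (leq_imset_card _ _))//.
by rewrite cardsT !card_prod card_tuple !card_ord mulnC.
Qed.

End counting.

Section kernel_sum.
Context d (T : measurableType d) (R : realType) (P : probability T R).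
Variable X : nat -> {RV P >-> R}.
Hypothesis X_indep : mutually_independent X.
Hypothesis X01 : forall i w, 0 < X i w < 1.
Hypothesis X_cdf : forall i (x : R), 0 < x < 1 -> cdf (X i) x = x%:E.

Let ker n (t : triple n) w := degenerate_kernel (X t.1.1 w) (X t.1.2 w) (X t.2 w).

(** The third index is unrestricted, because [H_n] is averaged over all sample points, including
    those that form the pair. *)
Definition kernel_sum n w :=
  \sum_(t : triple n | (t.1.1 < t.1.2)%N)
    degenerate_kernel (X t.1.1 w) (X t.1.2 w) (X t.2 w).

Let bker n (t : triple n) : bounded_mfun (ker t).
Proof. by apply: bounded_mfun_kernel; exact: measurable_funPT. Qed.

Lemma bounded_mfun_kernel_sum n : bounded_mfun (kernel_sum n).
Proof. by apply: bounded_mfun_sum => t _; exact: bker. Qed.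

Lemma kernel_sum_moment : exists2 C : R, 0 <= C & forall n,
  \int[P]_w (kernel_sum n w ^+ 2) <= C * n%:R ^+ 4.
Proof.
have [M kM] : exists M : R, forall x y z, `|degenerate_kernel x y z| <= M.
  have m1 : measurable_fun setT (fun p : R * (R * R) => p.1) by exact: measurable_fst.
  have m2 : measurable_fun setT (fun p : R * (R * R) => p.2.1).
    exact: (measurableT_comp measurable_fst measurable_snd).
  have m3 : measurable_fun setT (fun p : R * (R * R) => p.2.2).
    exact: (measurableT_comp measurable_snd measurable_snd).
  have [_ [M kM]] := bounded_mfun_kernel m1 m2 m3.
  by exists M => x y z; exact: (kM (x, (y, z))).
have M0 : 0 <= M := le_trans (normr_ge0 _) (kM 0 0 0).
exists (M ^+ 2 * (4 ^ 6)%:R) => [|n]; first by rewrite mulr_ge0// sqr_ge0.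
pose pr (p : triple n * triple n) := (p.1.1.1 < p.1.1.2)%N && (p.2.1.1 < p.2.1.2)%N.
have -> : \int[P]_w (kernel_sum n w ^+ 2) =
    \int[P]_w (\sum_(p : triple n * triple n | pr p) ker p.1 w * ker p.2 w).
  by apply: eq_Rintegral => w _; rewrite expr2 big_distrlr/= pair_big.
rewrite bounded_Rintegral_sum; last first.
  by move=> p _; apply: bounded_mfunM; exact: bker.
apply: (@le_trans _ _ (\sum_(p in few_values n) M ^+ 2)).
  rewrite big_mkcond [leRHS]big_mkcond/=; apply: ler_sum => -[t t'] _.
  case: ifPn => [/andP[/= tt tt']|_]; last by case: ifP => _; rewrite ?sqr_ge0.
  rewrite inE; case: ifPn => [_|].
    rewrite (le_trans (ler_norm _))//; apply: normr_Rintegral_le => [|w].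
      by apply: bounded_mfunM; exact: bker.
    by rewrite normrM expr2 ler_pM// kM.
  rewrite -ltnNge => H; move: t t' tt tt' H => [[i j] k] [[i' j'] k'] ij ij' H.
  have {}H : (4 < size (undup [:: i : nat; j : nat; k : nat; i' : nat; j' : nat; k' : nat]))%N.
    by move: H; rewrite -(size_map val) -(undup_map_inj val_inj).
  have /orP[H0|H0] := two_freeP (negbT (ltn_eqF ij)) (negbT (ltn_eqF ij')) H.
    by rewrite (kernel_orthogonal X_indep X01 X_cdf H0).
  under eq_Rintegral do rewrite mulrC.
  by rewrite (kernel_orthogonal X_indep X01 X_cdf H0).
rewrite sumr_const -[leLHS]mulr_natr -mulrA ler_wpM2l ?sqr_ge0//.
by rewrite -natrX -natrM ler_nat card_few_values.
Qed.

End kernel_sum.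

(** * The statistic *)

Section index_sums.
Context (R : realType).
Implicit Types (a : nat -> R) (n : nat).

(** Once the inner range depends on [j] alone, induction on [n] can peel off the last [j]. *)
Let narrow (F : nat -> nat -> R) n :
  \sum_(j < n) \sum_(i < n | (i < j)%N) F i j = \sum_(j < n) \sum_(i < j) F i j.
Proof.
apply: eq_bigr => j _.
by rewrite (big_ord_widen _ (fun i => F i j) (ltnW (ltn_ord j))).
Qed.

Lemma sum_ordered_pairs_cst (c : R) n :
  \sum_(j < n) \sum_(i < n | (i < j)%N) c = 'C(n, 2)%:R * c.
Proof.
rewrite (narrow (fun _ _ => c)); elim: n => [|n ih]; first by rewrite big_ord0 mul0r.
by rewrite big_ord_recr/= ih sumr_const card_ord binS bin1 natrD mulrDl -(mulr_natl c).
Qed.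

(** Each index lies in [n - 1] pairs. *)
Lemma sum_ordered_pairsD a n :
  \sum_(j < n) \sum_(i < n | (i < j)%N) (a i + a j) =
  (n%:R - 1) * \sum_(i < n) a i.
Proof.
rewrite (narrow (fun i j => a i + a j)).
elim: n => [|n ih]; first by rewrite !big_ord0 mulr0.
rewrite big_ord_recr/= ih big_split/= sumr_const card_ord big_ord_recr/= -mulr_natl.
by rewrite -[n.+1]addn1 natrD; ring.
Qed.

Lemma bin2r n : 'C(n, 2)%:R = n%:R * (n%:R - 1) / 2 :> R.
Proof.
elim: n => [|n ih]; first by rewrite !mul0r.
by rewrite binS bin1 natrD ih -[n.+1]addn1 natrD; field.
Qed.

(** The indicator of equality, written with the two strict comparisons so that sums and means follow
    by linearity. *)
Definition tie (x y : R) : R := 1 - (x < y)%R%:R - (y < x)%R%:R.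

Lemma tie01 x y : 0 <= tie x y <= 1.
Proof.
rewrite /tie; have [xy|yx|xy] := ltgtP x y; rewrite ?mulr1n ?mulr0n; lra.
Qed.

Definition tie_sum (x : nat -> R) n := \sum_(k < n) \sum_(i < n | i != k) tie (x i) (x k).

Lemma tie_sum_ge0 x n : 0 <= tie_sum x n.
Proof.
apply: sumr_ge0 => k _; apply: sumr_ge0 => i _.
by case/andP: (tie01 (x i) (x k)).
Qed.

Lemma tie_sum_le x n : tie_sum x n <= n%:R ^+ 2.
Proof.
apply: (@le_trans _ _ (\sum_(k < n) \sum_(i < n) (1 : R))); last first.
  by rewrite !sumr_const !card_ord -[leLHS]mulr_natl expr2.
apply: ler_sum => k _; rewrite big_mkcond; apply: ler_sum => i _.
by case: ifP => _; rewrite ?ler01//; case/andP: (tie01 (x i) (x k)).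
Qed.

(** Adding the sum with exchanged indices gives [1 - tie] for each ordered pair of distinct
    indices. *)
Lemma sum_ltr_tie (x : nat -> R) n :
  \sum_(k < n) \sum_(i < n) (x i < x k)%R%:R =
  (n%:R ^+ 2 - n%:R - tie_sum x n) / 2.
Proof.
set S := LHS; have E : S + S = n%:R ^+ 2 - n%:R - tie_sum x n.
  rewrite {2}/S exchange_big/= -big_split/=.
  transitivity (\sum_(k < n) (n%:R - 1 - \sum_(i < n | i != k) tie (x i) (x k))).
    apply: eq_bigr => k _; rewrite -big_split/= (bigD1 k)//= ltxx addr0 add0r.
    have -> : n%:R - 1 = \sum_(i < n | i != k) (1 : R).
      by rewrite sumr_const cardC1 card_ord -subn1 natrB// (leq_ltn_trans _ (ltn_ord k)).
    rewrite -sumrB; apply: eq_bigr => i _; rewrite /tie; ring.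
  by rewrite sumrB sumr_const card_ord -mulr_natl /tie_sum; ring.
by rewrite -E; field.
Qed.

End index_sums.

Section uniform_case.
Context d (T : measurableType d) (R : realType) (P : probability T R).
Variable X : nat -> {RV P >-> R}.
Hypothesis X_indep : mutually_independent X.
Hypothesis X01 : forall i w, 0 < X i w < 1.
Hypothesis X_cdf : forall i (x : R), 0 < x < 1 -> cdf (X i) x = x%:E.
Local Notation s := (Num.sqrt (5 / 108 : R)).
Local Notation W := (normalized_sum X (@score R)).
Local Notation x w := (fun i => X i w).

Let X01' i w : 0 <= X i w <= 1.
Proof. by have /andP[a b] := X01 i w; rewrite !ltW. Qed.

Lemma ratio_minE (i j : nat) w :
  ratio (X i w) (X j w) = Num.min (X i w / X j w) (X j w / X i w).
Proof.
have /andP[i0 _] := X01 i w; have /andP[j0 _] := X01 j w.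
by rewrite /ratio max_r// le_min !divr_ge0// ltW.
Qed.

(** An exact identity. The bias [1 / (2 sqrt n)] comes from [F_n]: its strict inequality leaves out
    the point itself. *)
Lemma I_PR_decomposition n w : (1 < n)%N ->
  Num.sqrt n%:R * I_PR (x w) n = W n w + ((Num.sqrt n%:R)^-1 / 2 +
    Num.sqrt n%:R / (2 * n%:R ^+ 2) * tie_sum (x w) n +
    Num.sqrt n%:R / (n%:R * 'C(n, 2)%:R) * kernel_sum X n w).
Proof.
move=> n1.
set G1 := \sum_(i < n) proj_pair (X i w); set G3 := \sum_(i < n) proj_threshold (X i w).
have HU : \sum_(k < n) U_empirical_df (x w) n (X k w) = 'C(n, 2)%:R^-1 *
    (kernel_sum X n w + n%:R * ('C(n, 2)%:R / 2 + (n%:R - 1) * G1) + 'C(n, 2)%:R * G3).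
  rewrite /U_empirical_df -mulr_sumr; congr (_ * _).
  have -> : kernel_sum X n w = \sum_(k < n) \sum_(j < n) \sum_(i < n | (i < j)%N)
      degenerate_kernel (X i w) (X j w) (X k w).
    transitivity (\sum_(p : 'I_n * 'I_n | (p.1 < p.2)%N) \sum_(k < n)
        degenerate_kernel (X p.1 w) (X p.2 w) (X k w)).
      by rewrite pair_big_dep; apply: eq_bigl => t; rewrite andbT.
    rewrite exchange_big/=; apply: eq_bigr => k _.
    transitivity (\sum_(i < n) \sum_(j < n | (i < j)%N)
        degenerate_kernel (X i w) (X j w) (X k w)); first by rewrite pair_big_dep.
    by rewrite (exchange_big_dep xpredT).
  have -> : n%:R * ('C(n, 2)%:R / 2 + (n%:R - 1) * G1) = \sum_(k < n)
      \sum_(j < n) \sum_(i < n | (i < j)%N) (1 / 2 + (proj_pair (X i w) + proj_pair (X j w))).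
    rewrite sumr_const card_ord -[RHS]mulr_natl; congr (_ * _).
    under [RHS]eq_bigr do rewrite big_split/=.
    rewrite big_split/= sum_ordered_pairs_cst (sum_ordered_pairsD (fun i => proj_pair (X i w))).
    by rewrite div1r.
  have -> : 'C(n, 2)%:R * G3 = \sum_(k < n) \sum_(j < n) \sum_(i < n | (i < j)%N)
      proj_threshold (X k w).
    by rewrite mulr_sumr; apply: eq_bigr => k _; rewrite sum_ordered_pairs_cst.
  rewrite -!big_split/=; apply: eq_bigr => k _; rewrite -!big_split/=.
  apply: eq_bigr => j _; rewrite -!big_split/=; apply: eq_bigr => i _.
  by rewrite -ratio_minE /degenerate_kernel; ring.
have HF : \sum_(k < n) empirical_df (x w) n (X k w) =
    n%:R^-1 * ((n%:R ^+ 2 - n%:R - tie_sum (x w) n) / 2).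
  by rewrite /empirical_df -mulr_sumr (sum_ltr_tie (x w)).
have HW : \sum_(i < n) score (X i w) = 2 * G1 + G3.
  by rewrite /score big_split/= -mulr_sumr.
rewrite /I_PR sumrB HU HF /normalized_sum HW bin2r.
(* With [q^2] for [n] both sides are rational functions of [q]; [1 < n] keeps the binomial
   coefficient away from 0. *)
set q := Num.sqrt n%:R.
have n0 : 0 < n%:R :> R by rewrite ltr0n (ltn_trans _ n1).
have q0 : q != 0 by rewrite gt_eqF// sqrtr_gt0.
have nq : n%:R = q ^+ 2 by rewrite sqr_sqrtr// ltW.
have n1' : q ^+ 2 - 1 != 0 by rewrite -nq subr_eq0 gt_eqF// ltr1n.
by rewrite nq; field; rewrite q0 n1'.
Qed.

Let bX (f : R -> R) i : bounded_mfun f -> bounded_mfun (fun w => f (X i w)).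
Proof. by move=> bf; apply: (bounded_mfun_comp _ bf); exact: measurable_funPT. Qed.

Let bltr (a b : nat) : bounded_mfun (fun w => (X a w < X b w)%R%:R : R).
Proof.
split; last by exists 1 => w; case: (_ < _); rewrite ?normr1 ?normr0.
have -> : (fun w => (X a w < X b w)%R%:R : R) = (fun w => if X a w < X b w then 1 else 0).
  by apply/funext => w; case: ifP.
by apply: measurable_fun_ifT => //; apply: measurable_fun_ltr; exact: measurable_funPT.
Qed.

Let btie i k : bounded_mfun (fun w => tie (X i w) (X k w)).
Proof.
apply: bounded_mfunB => //; apply: bounded_mfunB => //; exact: bounded_mfun_cst.
Qed.

(** Given [X i] the event has probability [1 - X i], of mean 1/2. *)
Let mean_ltr i k : i != k -> \int[P]_w (X i w < X k w)%R%:R = 1 / 2 :> R.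
Proof.
move=> ik; have kJ : k \notin [fset i]%fset by rewrite inE eq_sym.
have mi : measurable_fun setT (X i : sigma_cylinder X [fset i]%fset -> R).
  by apply: measurable_sigma_cylinder; rewrite inE.
pose f (z : (R * sigma_cylinder X [fset i]%fset)%type) : R := (X i z.2 < z.1)%R%:R.
have bf : bounded_mfun f.
  split; last by exists 1 => w; rewrite /f; case: (_ < _); rewrite ?normr1 ?normr0.
  have -> : f = (fun z => if X i z.2 < z.1 then 1 else 0).
    by apply/funext => z; rewrite /f; case: ifP.
  apply: measurable_fun_ifT => //; apply: measurable_fun_ltr => //.
  exact: (measurableT_comp mi measurable_snd).
have -> := indep_Rintegral X_indep kJ bf.
transitivity (\int[P]_w (1 - clamp (X i w))).
  apply: eq_Rintegral => w _; rewrite /f/= clamp_id//.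
  rewrite -(Rintegral_distribution P (X k) (bounded_mfun_ltr (X i w))).
  by rewrite (Rintegral_uniform (X01 k) (X_cdf k) (bounded_mfun_ltr _)) Rintegral_ltr.
rewrite bounded_RintegralB; [|exact: bounded_mfun_cst|exact: bX (bounded_mfun_clamp R)].
by rewrite Rintegral_prob_cst (mean_clamp X01 X_cdf); lra.
Qed.

Lemma mean_tie i k : i != k -> \int[P]_w tie (X i w) (X k w) = 0.
Proof.
move=> ik; rewrite /tie bounded_RintegralB//; last first.
  by apply: bounded_mfunB => //; exact: bounded_mfun_cst.
rewrite bounded_RintegralB//; last exact: bounded_mfun_cst.
by rewrite Rintegral_prob_cst !mean_ltr// 1?eq_sym//; lra.
Qed.

Let btie_sum n : bounded_mfun (fun w => tie_sum (x w) n).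
Proof. by do 2 apply: bounded_mfun_sum => ? _; exact: btie. Qed.

Let bsq (f : T -> R) : bounded_mfun f -> bounded_mfun (fun w => f w ^+ 2).
Proof. by move=> bf; under eq_fun do rewrite expr2; exact: bounded_mfunM. Qed.

(** From [0 <= tie_sum <= n^2] the second moment is at most [n^2] times the first, which is zero. *)
Lemma tie_sum_moment n : \int[P]_w (tie_sum (x w) n ^+ 2) <= 0.
Proof.
have mean0 : \int[P]_w tie_sum (x w) n = 0.
  rewrite /tie_sum bounded_Rintegral_sum; last first.
    by move=> k _; apply: bounded_mfun_sum => i _; exact: btie.
  apply: big1 => k _; rewrite bounded_Rintegral_sum; last by move=> i _; exact: btie.
  by apply: big1 => i ik; exact: mean_tie.
rewrite -(mulr0 (n%:R ^+ 2)) -mean0 -bounded_RintegralZ//.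
apply: bounded_le_Rintegral; [exact: bsq|exact: bounded_mfunZ|].
by move=> w; rewrite expr2 ler_wpM2r ?tie_sum_ge0// tie_sum_le.
Qed.

Let remainder n w : R := (Num.sqrt n%:R)^-1 / 2 +
    Num.sqrt n%:R / (2 * n%:R ^+ 2) * tie_sum (x w) n +
    Num.sqrt n%:R / (n%:R * 'C(n, 2)%:R) * kernel_sum X n w.

Let bremainder n : bounded_mfun (remainder n).
Proof.
apply: bounded_mfunD; last by apply: bounded_mfunZ; exact: bounded_mfun_kernel_sum.
by apply: bounded_mfunD; [exact: bounded_mfun_cst|exact: bounded_mfunZ].
Qed.

Lemma remainder_moment : exists D : R, forall n, (1 < n)%N ->
  \int[P]_w (remainder n w ^+ 2) <= D / n%:R.
Proof.
have [C C0 HC] := kernel_sum_moment X_indep X01 X_cdf.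
(* The factor 3 comes from [(a + u + v)^2 <= 3 (a^2 + u^2 + v^2)]: the bias gives [3/4], and the
   kernel sum gives [3 * 16 C], by [n^2 <= 4 (n - 1)^2] for [n >= 2]. *)
exists (3 / 4 + 48 * C) => n n1.
pose a : R := (Num.sqrt n%:R)^-1 / 2; pose b : R := Num.sqrt n%:R / (2 * n%:R ^+ 2).
pose c : R := Num.sqrt n%:R / (n%:R * 'C(n, 2)%:R).
have n0 : 0 < n%:R :> R by rewrite ltr0n (ltn_trans _ n1).
have bk := bsq (bounded_mfun_kernel_sum X n); have bt := bsq (btie_sum n).
have bt' := bounded_mfunZ (3 * b ^+ 2) bt; have bk' := bounded_mfunZ (3 * c ^+ 2) bk.
apply: (@le_trans _ _ (\int[P]_w (3 * b ^+ 2 * tie_sum (x w) n ^+ 2 +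
    3 * c ^+ 2 * kernel_sum X n w ^+ 2 - - (3 * a ^+ 2)))).
  apply: bounded_le_Rintegral; first exact: bsq.
    by apply: bounded_mfunB; [exact: bounded_mfunD|exact: bounded_mfun_cst].
  move=> w; rewrite /remainder -/a -/b -/c.
  set u := b * _; set v := c * _.
  have -> : 3 * b ^+ 2 * tie_sum (x w) n ^+ 2 = 3 * u ^+ 2 by rewrite /u; ring.
  have -> : 3 * c ^+ 2 * kernel_sum X n w ^+ 2 = 3 * v ^+ 2 by rewrite /v; ring.
  rewrite -subr_ge0.
  have -> : 3 * u ^+ 2 + 3 * v ^+ 2 - - (3 * a ^+ 2) - (a + u + v) ^+ 2 =
    (u - v) ^+ 2 + (v - a) ^+ 2 + (a - u) ^+ 2 by ring.
  by rewrite !addr_ge0// sqr_ge0.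
rewrite bounded_RintegralB; [|exact: bounded_mfunD|exact: bounded_mfun_cst].
rewrite bounded_RintegralD// !bounded_RintegralZ// Rintegral_prob_cst opprK.
have q2 : Num.sqrt n%:R ^+ 2 = n%:R :> R by rewrite sqr_sqrtr// ltW.
have a2 : a ^+ 2 = n%:R^-1 / 4.
  by rewrite /a expr_div_n exprVn q2; congr (_ / _); ring.
have t0 : 3 * b ^+ 2 * \int[P]_w (tie_sum (x w) n ^+ 2) <= 0.
  by rewrite mulr_ge0_le0 ?tie_sum_moment// mulr_ge0// sqr_ge0.
have n1' : 1 <= n%:R - 1 :> R by rewrite lerBrDr -(natrD _ 1 1) ler_nat.
have c2 : c ^+ 2 * (C * n%:R ^+ 4) <= 16 * C / n%:R.
  have -> : c ^+ 2 * (C * n%:R ^+ 4) = 4 * C * (n%:R / (n%:R - 1) ^+ 2).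
    rewrite /c bin2r expr_div_n q2; field.
    by rewrite !gt_eqF//; lra.
  have -> : 16 * C / n%:R = 4 * C * (4 / n%:R) by field; rewrite gt_eqF.
  rewrite ler_wpM2l ?mulr_ge0// ler_pdivrMr ?exprn_gt0//; last lra.
  by rewrite mulrAC ler_pdivlMr//; nra.
have k0 : 3 * c ^+ 2 * \int[P]_w (kernel_sum X n w ^+ 2) <= 48 * C / n%:R.
  rewrite -mulrA (le_trans (_ : _ <= 3 * (c ^+ 2 * (C * n%:R ^+ 4))))//.
    by rewrite ler_wpM2l// ler_wpM2l ?sqr_ge0.
  by rewrite (le_trans (ler_wpM2l _ c2))//; lra.
rewrite a2 mulrDl; lra.
Qed.

(** Off-diagonal products have mean zero by independence. An inequality, since at [n = 0] the sum is
    empty. *)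
Lemma variance_normalized_sum n : \int[P]_w (W n w ^+ 2) <= 5 / 108.
Proof.
have bs := bounded_mfun_score R.
have bsX j : bounded_mfun (fun w => score (X j w)) by exact: bX.
rewrite /normalized_sum.
have -> : \int[P]_w (((Num.sqrt n%:R)^-1 * \sum_(j < n) score (X j w)) ^+ 2) =
    n%:R^-1 * \sum_(j < n) \sum_(k < n) \int[P]_w (score (X j w) * score (X k w)).
  transitivity (n%:R^-1 * \int[P]_w (\sum_(j < n) \sum_(k < n) score (X j w) * score (X k w))).
    rewrite -bounded_RintegralZ; last first.
      by do 2 apply: bounded_mfun_sum => ? _; exact: bounded_mfunM.
    apply: eq_Rintegral => w _; rewrite exprMn exprVn sqr_sqrtr ?ler0n//; congr (_ * _).
    by rewrite expr2 big_distrlr.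
  congr (_ * _); rewrite bounded_Rintegral_sum; last first.
    by move=> j _; apply: bounded_mfun_sum => k _; exact: bounded_mfunM.
  apply: eq_bigr => j _; rewrite bounded_Rintegral_sum// => k _; exact: bounded_mfunM.
rewrite (eq_bigr (fun=> 5 / 108)); last first.
  move=> j _; rewrite (bigD1 j)//= big1 ?addr0.
    by rewrite -(variance_score X01 X_cdf j); apply: eq_Rintegral => w _; rewrite expr2.
  move=> k kj; have kJ : (j : nat) \notin [fset (k : nat)]%fset by rewrite inE eq_sym.
  have bk : bounded_mfun (fun w : sigma_cylinder X [fset (k : nat)]%fset => score (X k w)).
    apply: (bounded_mfun_comp _ bs); apply: measurable_sigma_cylinder.
    by rewrite inE.
  by rewrite (indep_RintegralM X_indep kJ bs bk) (mean_score X01 X_cdf) mul0r.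
rewrite sumr_const card_ord -[X in _ * X]mulr_natl mulrA.
have [->|n0] := eqVneq n 0%N; first by rewrite mulr0 mul0r divr_ge0.
by rewrite mulVf ?mul1r// pnatr_eq0.
Qed.

Lemma uniform_clt (y : R) :
  {for y, continuous (fun z : R => normal_prob 0 s `]-oo, z])} ->
  P ((fun w => Num.sqrt n%:R * I_PR (x w) n) @^-1` `]-oo, y]) @[n --> \oo] -->
  normal_prob 0 s `]-oo, y].
Proof.
move=> cy; pose V n w := W n w + remainder n w.
have s0 : 0 < s by rewrite sqrtr_gt0 divr_gt0.
have s2 : s ^+ 2 = 5 / 108 by rewrite sqr_sqrtr// divr_ge0.
have [ms [M sM]] := bounded_mfun_score R.
have bW n : bounded_mfun (W n) by exact: bounded_mfun_normalized_sum ms sM n.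
(* [V n] is known to equal the normalized statistic for [n > 1], so the two sequences are identified
   eventually. *)
apply: cvg_trans (_ : P (V n @^-1` `]-oo, y]) @[n --> \oo] --> _); last first.
  apply: (@slutsky_normal_cdf _ _ _ P s V W) => //.
  - by move=> n; exact: bounded_mfunD.
  - move=> K L g K0 gL gK g0.
    have [|C HC] := clt_test_function X_indep ms sM s0 (mean_score X01 X_cdf) _ K0 gL gK g0.
      by move=> j; rewrite s2; exact: variance_score.
    apply/cvgrPdist_le => e e0; near=> n; rewrite sub0r normrN.
    have n0 : (0 < n)%N by near: n; exact: nbhs_infty_gt.
    rewrite (le_trans (HC n n0))// ler_pdivrMr ?sqrtr_gt0 ?ltr0n// mulrC -ler_pdivrMr//.
    have : (C / e) ^+ 2 <= n%:R by near: n; exact: nbhs_infty_ger.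
    by move=> /ler_wsqrtr; rewrite sqrtr_sqr; exact: le_trans (ler_norm _).
  - by move=> n; rewrite s2; exact: variance_normalized_sum.
  - have [D HD] := remainder_moment.
    apply/cvgrPdist_le => e e0; near=> n.
    have n1 : (1 < n)%N by near: n; exact: nbhs_infty_gt.
    have De : D / e <= n%:R by near: n; exact: nbhs_infty_ger.
    rewrite sub0r normrN ger0_norm; last by apply: Rintegral_ge0 => w _; exact: sqr_ge0.
    have -> : \int[P]_w ((V n w - W n w) ^+ 2) = \int[P]_w (remainder n w ^+ 2).
      by apply: eq_Rintegral => w _; rewrite /V addrC addKr.
    rewrite (le_trans (HD n n1))// ler_pdivrMr ?ltr0n ?(ltn_trans _ n1)//.
    by rewrite mulrC -ler_pdivrMr.
apply: near_eq_cvg; near=> n.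
have n1 : (1 < n)%N by near: n; exact: nbhs_infty_gt.
by congr (P _); apply/seteqP; split => w /=; rewrite I_PR_decomposition.
Unshelve. all: by end_near. Qed.

End uniform_case.

(** * Reduction of a general exponent to the uniform law *)

Section power_transform.
Context (R : realType) (lambda : R).
Hypothesis lambda_gt0 : 0 < lambda.

Lemma ltr_powR (x y : R) : 0 < x -> 0 < y -> (x `^ lambda < y `^ lambda) = (x < y).
Proof.
move=> x0 y0; have H := gt0_ltr_powR lambda_gt0.
have [xy|xy|->] := ltgtP x y; last by rewrite ltxx.
  by rewrite H ?nnegrE ?ltW.
by apply/negbTE; rewrite -leNgt ltW// H ?nnegrE ?ltW.
Qed.

Lemma powR_div (x y : R) : 0 < x -> 0 < y -> (x / y) `^ lambda = x `^ lambda / y `^ lambda.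
Proof.
move=> x0 y0; have E : (x / y) `^ lambda * y `^ lambda = x `^ lambda.
  by rewrite -powRM ?divr_ge0 ?ltW// divfK// gt_eqF.
by rewrite -E mulfK// gt_eqF// powR_gt0.
Qed.

Lemma I_PR_powR (x : nat -> R) n : (forall i, 0 < x i) ->
  I_PR (fun i => x i `^ lambda) n = I_PR x n.
Proof.
move=> x0; rewrite /I_PR; congr (_ * _); apply: eq_bigr => k _; congr (_ - _).
  rewrite /U_empirical_df; congr (_ * _); apply: eq_bigr => j _; apply: eq_bigr => i _.
  by rewrite -!powR_div// !gt_min !ltr_powR// divr_gt0.
by rewrite /empirical_df; congr (_ * _); apply: eq_bigr => i _; rewrite ltr_powR.
Qed.

End power_transform.

Unset Implicit Arguments.

Theorem mainTheorem3 (d : measure_display) (T : measurableType d)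
    (R : realType) (P : probability T R) (X : nat -> {RV P >-> R})
    (lambda : R) (lambda_gt0 : 0 < lambda)
    (X_01 : forall i w, 0 < X i w < 1)
    (X_indep : mutually_independent X)
    (X_cdf : forall (i : nat) (x : R), 0 < x < 1 -> cdf (X i) x = (x `^ lambda)%:E) :
  cvg_in_distribution (fun n => Num.sqrt n%:R \o* I_PR_stat X n : {RV P >-> R})
    (normal_prob 0 (Num.sqrt (5 / 108))).
Proof.
have X0 i w : 0 < X i w by case/andP: (X_01 i w).
have mpow : measurable_fun setT (fun x : R => x `^ lambda) by exact: measurable_powR.
have mU i : measurable_fun setT (fun w => X i w `^ lambda).
  by apply: (measurableT_comp mpow); exact: measurable_funPT.
pose U i : {RV P >-> R} := mfun_Sub (mem_set (mU i)).
have U01 i w : 0 < U i w < 1.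
  rewrite /U /= powR_gt0//= -[ltRHS](_ : 1 `^ lambda = 1); last by rewrite powR1.
  by rewrite ltr_powR//; case/andP: (X_01 i w).
have U_indep : mutually_independent U.
  move=> J B mB.
  apply: (X_indep J (fun i => (fun x : R => x `^ lambda) @^-1` B i)) => i.
  by rewrite -[_ @^-1` _]setTI; exact: mpow.
have U_cdf i (x : R) : 0 < x < 1 -> cdf (U i) x = x%:E.
  (* [y] is the quantile: [U i <= x] is the event [X i <= y], of probability [y^lambda = x]. *)
  move=> /andP[x0 x1]; pose y := x `^ lambda^-1.
  have y0 : 0 < y by exact: powR_gt0.
  have yx : y `^ lambda = x by rewrite /y -powRrM mulVf ?gt_eqF// powRr1// ltW.
  have y1 : y < 1 by rewrite -(ltr_powR lambda_gt0)// powR1 yx.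
  rewrite -[in RHS]yx -(X_cdf i) ?y0//; congr (P _); apply/seteqP.
  by split => w /=; rewrite !in_itv/= !leNgt -{1}yx ltr_powR.
move=> x cx.
have := uniform_clt U_indep U01 U_cdf cx; apply: cvg_trans.
apply: near_eq_cvg; apply: nearW => n; congr (P _); apply/seteqP.
by split => w /=; rewrite in_itv/= I_PR_powR// mulrC in_itv.
Qed.
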